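(* Let $K$ be a field of characteristic $p>0$, let $k=\bigcap_{n\ge 0}K^{p^n}$, and assume $K/k$ is a finitely generated field extension. There are natural bijections between the following three sets: (1) power towers on $K$; (2) Jacobson sequences on $K$; (3) $K$-subalgebras $\mathcal{D}$ with $K\subseteq \mathcal{D}\subseteq \operatorname{Diff}_k(K)$. These bijections are given explicitly by: (a) power tower to Jacobson sequence: $W_\bullet\mapsto (T_{W_0/W_1},T_{W_1/W_2},T_{W_2/W_3},\ldots)$; (b) Jacobson sequence to power tower: $(\mathcal{F}_1,\mathcal{F}_2,\ldots)\mapsto (W_n)_{n\ge 0}$ with $W_0=K$ and $W_n=\operatorname{Ann}(\mathcal{F}_n)$ for $n\ge 1$; (c) power tower to subalgebra: $W_\bullet\mapsto \operatorname{Diff}_{W_\bullet}(K):=\bigcup_{n\ge 0}\operatorname{Diff}_{W_n}(K)$; (d) subalgebra to Jacobson sequence (''unpacking''): $\mathcal{D}\mapsto(\mathcal{F}_1,\mathcal{F}_2,\ldots)$ with $\mathcal{F}_1=\mathcal{D}\cap TK$ and $\mathcal{F}_n=d(K/W_{n-1})(\mathcal{D})\cap TW_{n-1}$ for $n\ge 1$, where $W_\bullet$ is the power tower corresponding to $\mathcal{D}$, namely $W_m=\{x\in K: xE=Ex \text{ for all } E\in \mathcal{D}\cap\operatorname{Diff}_{K^{p^m}}(K)\}$. Moreover, for a power tower $W_\bullet$ with associated Jacobson sequence $(\mathcal{F}_i)$, the ranks $\operatorname{rk}(\mathcal{F}_i):=\dim_{W_{i-1}}(\mathcal{F}_i)$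 are finite and nonincreasing, $\operatorname{rk}(\mathcal{F}_i)\ge\operatorname{rk}(\mathcal{F}_{i+1})$, and $p^{\operatorname{rk}(\mathcal{F}_i)}=\dim_{W_i}(W_{i-1})$ for all $i\ge 1$.
   Context: A power tower on $K$ is a sequence of subfields $W_0,W_1,W_2,\ldots$ of $K$ such that $W_j=W_i\cdot K^{p^j}$ whenever $j\le i$ (here $\cdot$ denotes the compositum in $K$; in particular $W_0=K$). For a field $F$ of characteristic $p$, $TF$ denotes the $F$-vector space of derivations of $F$, and for a subfield $A\subseteq F$, $T_{F/A}$ denotes the derivations of $F$ vanishing on $A$. A $p$-Lie algebra on $F$ is an $F$-subspace $L\subseteq TF$ closed under the commutator $[D,E]=DE-ED$ and under $p$-th powers $D\mapsto D^p$ (the $p$-fold composite). For such $L$, $\operatorname{Ann}(L)=\{x\in F: D(x)=0\ \forall D\in L\}$. A Jacobson sequence on $K$ is a sequence $(\mathcal{F}_1,\mathcal{F}_2,\ldots)$ with $\mathcal{F}_1$ a $p$-Lie algebra on $K$ and, for each $i\ge 1$, $\mathcal{F}_{i+1}$ a $p$-Lie algebra on the field $\operatorname{Ann}(\mathcal{F}_i)$ with $\mathcal{F}_{i+1}\cap T_{\operatorname{Ann}(\mathcal{F}_i)/K^{p^i}}=0$. For subfields $A\subseteq B$, $\operatorname{Diff}_A(B)$ is the algebra of differential operators on $B$ relative to $A$: the union over $n\ge 0$ of the sets of $A$-linear maps $D:B\to B$ such that $[b_0,[b_1,[\ldots,[b_n,D]\ldots]]]=0$ for all $b_0,\ldots,b_n\in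 B$ (elements of $B$ acting by multiplication); it is a subalgebra of $\operatorname{End}_A(B)$ containing $B$. For a subfield $k\subseteq W\subseteq K$, the differential $d(K/W)$ sends $D\in\operatorname{Diff}_k(K)$ to its restriction $D|_W:W\to K$; its image lies in $\operatorname{Diff}_k(W)\otimes_W K$, identified with the $K$-linear span in $\operatorname{Hom}(W,K)$ of the maps $\iota\circ E$, $E\in \operatorname{Diff}_k(W)$, $\iota:W\to K$ the inclusion; $TW$ is viewed inside it via $E\mapsto\iota\circ E$. For $W=K$, $d(K/K)$ is the identity. *)

(* Defs.v *)
From mathcomp Require Import all_boot all_algebra.

Set Implicit Arguments.
Unset Strict Implicit.
Unset Printing Implicit Defensive.

Import GRing.Theory.
Local Open Scope ring_scope.

(* Conventions:
   - subsets of K are predicates  K -> Prop;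
   - a map on a subfield F (derivation of F, differential operator on F)
     is represented by a function K -> K which maps F into F and is 0
     outside F (extension by zero), so equality of such maps is Leibniz
     equality of functions;
   - sets of maps are predicates (K -> K) -> Prop;
   - Jacobson sequences are indexed from 0: J i stands for F_(i+1). *)

Section Defs.
Variables (K : fieldType) (p : nat).

Definition fullK : K -> Prop := fun _ => True.

Definition is_subfield (S : K -> Prop) : Prop :=
  S 0 /\ S 1 /\ (forall x y, S x -> S y -> S (x + y)) /\
  (forall x, S x -> S (- x)) /\
  (forall x y, S x -> S y -> S (x * y)) /\
  (forall x, S x -> S (x^-1)).

Definition gen_field (A : K -> Prop) : K -> Prop :=
  fun x => forall S, is_subfield S -> (forall y, A y -> S y) -> S x.

Definition compositum (A B : K -> Prop) : K -> Prop :=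
  gen_field (fun x => A x \/ B x).

Definition frob_pow (n : nat) : K -> Prop :=
  fun y => exists x : K, y = x ^+ (p ^ n).

Definition perfect_core : K -> Prop := fun y => forall n, frob_pow n y.

Definition fin_gen_over (k : K -> Prop) : Prop :=
  exists s : seq K, forall x, gen_field (fun y => k y \/ y \in s) x.

Definition power_tower (W : nat -> K -> Prop) : Prop :=
  (forall i, is_subfield (W i)) /\
  (forall i j, (j <= i)%N -> W j = compositum (W i) (frob_pow j)).

Definition zero_fun : K -> K := fun _ => 0.
Definition add_fun (D E : K -> K) : K -> K := fun x => D x + E x.
Definition scale_fun (a : K) (D : K -> K) : K -> K := fun x => a * D x.
Definition mul_op (a : K) : K -> K := fun x => a * x.
Definition comp_op (D E : K -> K) : K -> K := fun x => D (E x).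
Definition lie_br (D E : K -> K) : K -> K := fun x => D (E x) - E (D x).
Definition pth_pow (D : K -> K) : K -> K := fun x => iter p D x.

Definition is_derivation (F : K -> Prop) (D : K -> K) : Prop :=
  [/\ (forall x, ~ F x -> D x = 0),
      (forall x, F x -> F (D x)),
      (forall x y, F x -> F y -> D (x + y) = D x + D y) &
      (forall x y, F x -> F y -> D (x * y) = x * D y + y * D x)].

Definition TF (F : K -> Prop) : (K -> K) -> Prop := is_derivation F.

Definition rel_der (F A : K -> Prop) : (K -> K) -> Prop :=
  fun D => is_derivation F D /\ (forall x, A x -> D x = 0).

Definition der_subspace (F : K -> Prop) (L : (K -> K) -> Prop) : Prop :=
  [/\ (forall D, L D -> is_derivation F D), L zero_fun,
      (forall D E, L D -> L E -> L (add_fun D E)) &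
      (forall a D, F a -> L D -> L (scale_fun a D))].

Definition p_lie (F : K -> Prop) (L : (K -> K) -> Prop) : Prop :=
  [/\ der_subspace F L,
      (forall D E, L D -> L E -> L (lie_br D E)) &
      (forall D, L D -> L (pth_pow D))].

Definition Ann (F : K -> Prop) (L : (K -> K) -> Prop) : K -> Prop :=
  fun x => F x /\ (forall D, L D -> D x = 0).

Fixpoint jbase (J : nat -> (K -> K) -> Prop) (n : nat) : K -> Prop :=
  match n with
  | 0 => fullK
  | n'.+1 => Ann (jbase J n') (J n')
  end.

Definition jacobson_seq (J : nat -> (K -> K) -> Prop) : Prop :=
  p_lie fullK (J 0) /\
  (forall i, p_lie (jbase J i.+1) (J i.+1) /\
     (forall D, J i.+1 D -> rel_der (jbase J i.+1) (frob_pow i.+1) D ->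
        D = zero_fun)).

Fixpoint iter_comm (bs : seq K) (D : K -> K) : K -> K :=
  match bs with
  | [::] => D
  | b :: bs' => fun x => b * iter_comm bs' D x - iter_comm bs' D (b * x)
  end.

Definition is_diffop (A B : K -> Prop) (D : K -> K) : Prop :=
  [/\ (forall x, ~ B x -> D x = 0),
      (forall x, B x -> B (D x)),
      (forall x y, B x -> B y -> D (x + y) = D x + D y),
      (forall a x, A a -> B x -> D (a * x) = a * D x) &
      exists n : nat, forall bs : seq K, size bs = n.+1 ->
        (forall b, b \in bs -> B b) -> iter_comm bs D = zero_fun].

Definition diff_subalg (k : K -> Prop) (Dd : (K -> K) -> Prop) : Prop :=
  [/\ (forall a, Dd (mul_op a)),
      (forall D E, Dd D -> Dd E -> Dd (add_fun D E)),
      (forall D E, Dd D -> Dd E -> Dd (comp_op D E)) &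
      (forall D, Dd D -> is_diffop k fullK D)].

Definition tower_to_jac (W : nat -> K -> Prop) : nat -> (K -> K) -> Prop :=
  fun i => rel_der (W i) (W i.+1).

Definition jac_to_tower (J : nat -> (K -> K) -> Prop) : nat -> K -> Prop :=
  jbase J.

Definition tower_to_alg (W : nat -> K -> Prop) : (K -> K) -> Prop :=
  fun D => exists n, is_diffop (W n) fullK D.

Definition alg_to_tower (Dd : (K -> K) -> Prop) : nat -> K -> Prop :=
  fun m x => forall E, Dd E -> is_diffop (frob_pow m) fullK E ->
    forall y, x * E y = E (x * y).

Definition alg_to_jac (Dd : (K -> K) -> Prop) : nat -> (K -> K) -> Prop :=
  fun i E' => TF (alg_to_tower Dd i) E' /\
    exists E, Dd E /\ (forall x, alg_to_tower Dd i x -> E x = E' x).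

Definition der_dim (F : K -> Prop) (L : (K -> K) -> Prop) (r : nat) : Prop :=
  exists b : 'I_r -> (K -> K),
    [/\ (forall i, L (b i)),
        (forall c : 'I_r -> K, (forall i, F (c i)) ->
           (fun x => \sum_i c i * b i x) = zero_fun -> forall i, c i = 0) &
        (forall E, L E -> exists c : 'I_r -> K,
           (forall i, F (c i)) /\ E = (fun x => \sum_i c i * b i x))].

Definition field_dim (F V : K -> Prop) (r : nat) : Prop :=
  exists b : 'I_r -> K,
    [/\ (forall i, V (b i)),
        (forall c : 'I_r -> K, (forall i, F (c i)) ->
           \sum_i c i * b i = 0 -> forall i, c i = 0) &
        (forall v, V v -> exists c : 'I_r -> K,
           (forall i, F (c i)) /\ v = \sum_i c i * b i)].

End Defs.

(* Main.v *)
Require Import Defs.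
From mathcomp Require Import all_boot all_algebra.
From mathcomp Require Import boolp.
From mathcomp Require Import ring zify.

(** The hypothesis on K is only used through: K is finite over every K^(p^m).
    Operators of finite order are then exactly the maps that are K^(p^m)-linear
    for some m, because (ad y)^(p^m) = ad (y^(p^m)).

    Both Galois correspondences rest on the same device. In a finite-dimensional
    space V of maps, choose b_i in V and points x_j with b_i(x_j) = delta_ij;
    every E in V is then the sum of the E(x_i) b_i, so an identity in V need only
    be tested at the x_j. If V is an algebra of operators containing K, this gives
    the Jacobson-Bourbaki theorem, V = End_W(K) for W the commutant of V. If V is
    a p-Lie algebra of derivations, it shows that the b_i commute and that
    b_i^p = 0, and Taylor expansion in the x_i yields Jacobson's theorem
    V = T_(F/Ann V) together with [F : Ann V] = p^(dim V).

    Conversely, derivations of an extension F/A of exponent one detect every x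
    outside A: take a field M between A and F maximal without x; then F = M(x),
    and the derivation d/dx of M(x)/M is extracted from a linear form by iterating
    ad x. *)

Set Implicit Arguments.
Unset Strict Implicit.
Unset Printing Implicit Defensive.

Import GRing.Theory.


(** * Subfields as predicates, composita, adjunction of one element *)

Section Subfields.
Local Open Scope ring_scope.
Variable K : fieldType.
Implicit Types (S M A B : K -> Prop) (x y : K).

Section Closure.
Variable S : K -> Prop.
Hypothesis sfS : is_subfield S.

Lemma subfield0 : S 0. Proof. by case: sfS. Qed.
Lemma subfield1 : S 1. Proof. by case: sfS => _ []. Qed.
Lemma subfieldD x y : S x -> S y -> S (x + y).
Proof. by case: sfS => _ [_ [+ _]]; apply. Qed.
Lemma subfieldN x : S x -> S (- x).
Proof. by case: sfS => _ [_ [_ [+ _]]]; apply. Qed.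
Lemma subfieldB x y : S x -> S y -> S (x - y).
Proof. by move=> Sx Sy; apply/subfieldD/subfieldN. Qed.
Lemma subfieldM x y : S x -> S y -> S (x * y).
Proof. by case: sfS => _ [_ [_ [_ [+ _]]]]; apply. Qed.
Lemma subfieldV x : S x -> S x^-1.
Proof. by case: sfS => _ [_ [_ [_ [_ +]]]]; apply. Qed.
Lemma subfieldX x n : S x -> S (x ^+ n).
Proof.
move=> Sx; elim: n => [|n IHn]; first exact: subfield1.
by rewrite exprS; apply: subfieldM.
Qed.
Lemma subfield_sum (I : Type) (r : seq I) (P : pred I) (F : I -> K) :
  (forall i, P i -> S (F i)) -> S (\sum_(i <- r | P i) F i).
Proof.
by move=> SF; elim/big_ind: _ => //; [exact: subfield0 | exact: subfieldD].
Qed.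
Lemma subfield_nat n : S n%:R.
Proof.
elim: n => [|n IHn]; first exact: subfield0.
by rewrite -addn1 natrD; apply: subfieldD IHn subfield1.
Qed.

End Closure.

Lemma fullK_subfield : is_subfield (@fullK K).
Proof. by []. Qed.

Lemma gen_fieldP A : is_subfield (gen_field A).
Proof.
split; first by move=> S sfS _; exact: subfield0.
split; first by move=> S sfS _; exact: subfield1.
split; first by move=> x y Ax Ay S sfS AS; apply: subfieldD; [|apply: Ax|apply: Ay].
split; first by move=> x Ax S sfS AS; apply: subfieldN; [|apply: Ax].
split; first by move=> x y Ax Ay S sfS AS; apply: subfieldM; [|apply: Ax|apply: Ay].
by move=> x Ax S sfS AS; apply: subfieldV; [|apply: Ax].
Qed.

Lemma compositum_subfield A B : is_subfield (compositum A B).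
Proof. exact: gen_fieldP. Qed.

Lemma compositum_l A B x : A x -> compositum A B x.
Proof. by move=> Ax S _ AS; apply: AS; left. Qed.

Lemma compositum_r A B x : B x -> compositum A B x.
Proof. by move=> Bx S _ BS; apply: BS; right. Qed.

Lemma compositum_sub A B S x : is_subfield S ->
  (forall y, A y -> S y) -> (forall y, B y -> S y) -> compositum A B x -> S x.
Proof. by move=> sfS AS BS; apply=> // y []; [apply: AS | apply: BS]. Qed.

(* The values at y of the polynomials of degree < q over M; this is the field
   M(y) as soon as y^q lies in M and K is purely inseparable over M. *)
Definition adj M q y : K -> Prop :=
  fun x => exists2 c : nat -> K, (forall i, M (c i)) &
    x = \sum_(i < q) c i * y ^+ i.

Section Adjunction.
Variables (M : K -> Prop) (q : nat) (y : K).
Hypotheses (sfM : is_subfield M) (q_gt0 : (0 < q)%N) (Myq : M (y ^+ q)).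

Lemma adj_const x : M x -> adj M q y x.
Proof.
move=> Mx; exists (fun i => if i is 0 then x else 0).
  by case=> [|i] //; exact: subfield0.
rewrite -(prednK q_gt0) big_ord_recl mulr1 big1 ?addr0 // => i _.
by rewrite mul0r.
Qed.

Lemma adjD x z : adj M q y x -> adj M q y z -> adj M q y (x + z).
Proof.
case=> c Mc -> [d Md ->]; exists (fun i => c i + d i).
  by move=> i; apply: subfieldD.
by rewrite -big_split; apply: eq_bigr => i _; rewrite mulrDl.
Qed.

Lemma adjZ a x : M a -> adj M q y x -> adj M q y (a * x).
Proof.
move=> Ma [c Mc ->]; exists (fun i => a * c i).
  by move=> i; apply: subfieldM.
by rewrite mulr_sumr; apply: eq_bigr => i _; rewrite mulrA.
Qed.

Lemma adj_shift x : adj M q y x -> adj M q y (y * x).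
Proof.
case=> c Mc ->.
(* Coefficients move up by one; the top one wraps around to the constant term because [y ^+ q] is a
   scalar of [M]. *)
exists (fun i => if i is j.+1 then c j else c q.-1 * y ^+ q).
  by case=> [|i] //; apply: subfieldM.
move: (Mc) Myq; rewrite -(prednK q_gt0) /= => _ _.
rewrite [RHS]big_ord_recl mulr_sumr big_ord_recr addrC /=; congr (_ + _).
  by apply: eq_bigr => i _; rewrite add0n /bump add1n exprS; ring.
by rewrite exprS; ring.
Qed.

(** Lets statements about [adj M q y] be proved from generators, without handling coefficients
    again. *)
Lemma adj_ind (P : K -> Prop) : P 1 ->
  (forall a b, P a -> P b -> P (a + b)) -> (forall m a, M m -> P a -> P (m * a)) ->
  (forall a, P a -> P (y * a)) -> forall x, adj M q y x -> P x.
Proof.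
move=> P1 PD PZ Py x [c Mc ->].
have P0 : P 0 by rewrite -(mul0r 1); apply: PZ => //; exact: subfield0.
elim/big_ind: _ => // i _; apply: PZ => //.
by elim: (i : nat) => [|n IHn] //; rewrite exprS; apply: Py.
Qed.

Lemma adjM x z : adj M q y x -> adj M q y z -> adj M q y (x * z).
Proof.
move=> xM zM; move: x xM; apply: adj_ind => [|a b|m a Mm|a].
- by rewrite mul1r.
- by rewrite mulrDl; apply: adjD.
- by rewrite -mulrA; apply: adjZ.
by rewrite -mulrA; apply: adj_shift.
Qed.

Lemma adj_gen : adj M q y y.
Proof.
rewrite -[X in adj M q y X]mulr1; apply: adj_shift.
by apply: adj_const; apply: subfield1.
Qed.

(** Inverses are the only issue: [x^-1] is the scalar [x^-1 ^+ n] of [M] times the power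
    [x ^+ n.-1]. *)
Lemma adj_subfield n : (0 < n)%N -> (forall x, M (x ^+ n)) ->
  is_subfield (adj M q y).
Proof.
move=> n_gt0 Mn; split; first exact: adj_const (subfield0 sfM).
split; first exact: adj_const (subfield1 sfM).
split; first exact: adjD.
split; first by move=> x Ax; rewrite -mulN1r; apply: adjZ => //;
  exact: subfieldN (subfield1 sfM).
split; first exact: adjM.
move=> x Ax; have -> : x^-1 = x^-1 ^+ n * x ^+ n.-1.
  have [->|xN0] := eqVneq x 0; first by rewrite invr0 expr0n gtn_eqF ?mul0r.
  by rewrite -{1}(prednK n_gt0) exprS -mulrA -exprMn mulVf // expr1n mulr1.
apply: adjZ => //; elim: n.-1 => [|k IHk]; first exact: adj_const (subfield1 sfM).
by rewrite exprS; apply: adjM.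
Qed.

Lemma adj_min S x : is_subfield S -> (forall z, M z -> S z) -> S y ->
  adj M q y x -> S x.
Proof.
move=> sfS MS Sy [c Mc ->]; apply: subfield_sum => // i _.
by apply: subfieldM => //; [apply: MS | apply: subfieldX].
Qed.

End Adjunction.

End Subfields.

(** * Frobenius powers and finiteness of [K] over each K^(p^m) *)

Section Frobenius.
Local Open Scope ring_scope.
Variables (K : fieldType) (p : nat).
Hypothesis hp : p \in [pchar K].
Implicit Types (S M A B N : K -> Prop) (x y : K).

Lemma pchar_gt0 : (0 < p)%N.
Proof. exact: prime_gt0 (pcharf_prime hp). Qed.

Lemma pexp_gt0 m : (0 < p ^ m)%N.
Proof. by rewrite expn_gt0 pchar_gt0. Qed.

Lemma pexp_pnat m : [pchar K].-nat (p ^ m)%N.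
Proof.
by rewrite (eq_pnat _ (pcharf_eq hp)) pnatX pnat_id ?orbT //; apply: pcharf_prime hp.
Qed.

Lemma pexpD m x y : (x + y) ^+ (p ^ m) = x ^+ (p ^ m) + y ^+ (p ^ m).
Proof. exact: exprDn_pchar (pexp_pnat m). Qed.

Lemma pexpN m x : (- x) ^+ (p ^ m) = - x ^+ (p ^ m).
Proof. exact: exprNn_pchar (pexp_pnat m). Qed.

Lemma frob_pow_subfield m : is_subfield (@frob_pow K p m).
Proof.
split; first by exists 0; rewrite expr0n gtn_eqF // pexp_gt0.
split; first by exists 1; rewrite expr1n.
split; first by move=> _ _ [x ->] [y ->]; exists (x + y); rewrite pexpD.
split; first by move=> _ [x ->]; exists (- x); rewrite pexpN.
split; first by move=> _ _ [x ->] [y ->]; exists (x * y); rewrite exprMn.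
by move=> _ [x ->]; exists x^-1; rewrite exprVn.
Qed.

Lemma frob_pow0 : @frob_pow K p 0 = @fullK K.
Proof. by apply/predeqP => x; split=> // _; exists x; rewrite expr1. Qed.

Lemma frob_pow_le i j x : (i <= j)%N -> frob_pow p j x -> frob_pow p i x.
Proof.
move=> /subnK <- [y ->]; exists (y ^+ (p ^ (j - i))).
by rewrite -exprM -expnD.
Qed.

Lemma frob_powS m x : frob_pow p m x -> frob_pow p m.+1 (x ^+ p).
Proof. by case=> y ->; exists y; rewrite -exprM expnSr. Qed.

Lemma perfect_core_frob m x : perfect_core p x -> frob_pow p m x.
Proof. by apply. Qed.

Definition frob_span m (I : finType) (b : I -> K) : K -> Prop :=
  fun x => exists c : I -> K, x = \sum_i c i ^+ (p ^ m) * b i.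

Definition frob_finite : Prop :=
  forall m, exists (I : finType) (b : I -> K), forall x, frob_span m b x.

(** Starting from K^(p^m), which contains the perfect core, the generators are adjoined one at a
    time. As y^q is a scalar for q = p^m, adjoining y replaces a spanning family b_j by the products
    b_j y^i with i < q. *)
Lemma fin_gen_frob_finite : fin_gen_over (@perfect_core K p) -> frob_finite.
Proof.
case=> s gen_s m; set q := (p ^ m)%N; have q_gt0 : (0 < q)%N := pexp_gt0 m.
suff [M [sfM kM sM [I [b spanM]]]] : exists M, [/\ is_subfield M,
    (forall x, frob_pow p m x -> M x), (forall x, x \in s -> M x) &
    exists (I : finType) (b : I -> K), forall x, M x -> frob_span m b x].
  exists I, b => x; apply: spanM; apply: (gen_s x) => // y [ky|]; last exact: sM.
  exact: kM.
elim: s {gen_s} => [|y s [M [sfM kM sM [I [b spanM]]]]].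
  exists (frob_pow p m); split=> //; first exact: frob_pow_subfield.
  exists 'I_1, (fun=> 1) => _ [x ->]; exists (fun=> x).
  by rewrite big_ord1 mulr1.
have MX z : M (z ^+ q) by apply: kM; exists z.
exists (adj M q y); split.
- by apply: (@adj_subfield _ _ _ _ _ _ _ q).
- by move=> x /kM; apply: adj_const.
- move=> x; rewrite inE => /predU1P[->|/sM]; first exact: adj_gen.
  exact: adj_const.
exists ('I_q * I)%type, (fun ij : 'I_q * I => b ij.2 * y ^+ ij.1) => _ [c Mc ->].
have /choice[d dE] : forall i, exists e : I -> K,
    c i = \sum_j e j ^+ (p ^ m) * b j by move=> i; apply: spanM.
exists (fun ij : 'I_q * I => d ij.1 ij.2).
rewrite -(pair_bigA _ (fun (i : 'I_q) j =>
  d i j ^+ (p ^ m) * (b j * y ^+ i))) /=.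
apply: eq_bigr => i _; rewrite dE mulr_suml; apply: eq_bigr => j _ /=.
by rewrite mulrA.
Qed.

(* A relation over K^(p^m) between the x_i is the image under Frobenius of a
   vector in the kernel of a matrix over K. *)
Lemma frob_dependent m (I : finType) (b : I -> K) r (x : nat -> K) :
  (forall y, frob_span m b y) -> (#|I| < r)%N ->
  exists2 v : nat -> K, \sum_(i < r) v i ^+ (p ^ m) * x i = 0 &
    exists2 i, (i < r)%N & v i != 0.
Proof.
move=> span_b ltIr.
have /choice[c cE] : forall i, exists c : I -> K,
  x i = \sum_l c l ^+ (p ^ m) * b l by move=> i; apply: span_b.
pose C : 'M[K]_(r, #|I|) := \matrix_(i, l) c i (enum_val l).
have : ~~ row_free C by rewrite /row_free neq_ltn (leq_ltn_trans (rank_leq_col C)).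
rewrite -kermx_eq0 => /matrix0Pn[k [j kj0]].
exists (fun i => if insub i is Some i' then kermx C k i' else 0); last first.
  by exists j; rewrite // valK.
under eq_bigr => i _ do rewrite valK cE mulr_sumr.
rewrite exchange_big big1 // => l _ /=.
have := congr1 (fun A : 'M__ => A k (enum_rank l) ^+ (p ^ m)) (mulmx_ker C).
rewrite !mxE expr0n (gtn_eqF (pexp_gt0 m)) => kC0.
transitivity ((\sum_(j0 < r) kermx C k j0 * C j0 (enum_rank l)) ^+ (p ^ m) * b l);
  last by rewrite kC0 mul0r.
rewrite (big_morph (fun z => z ^+ (p ^ m)) (pexpD m) (_ : _ = 0)); last first.
  by rewrite expr0n gtn_eqF // pexp_gt0.
rewrite mulr_suml; apply: eq_bigr => i _ /=.
by rewrite !mxE enum_rankK exprMn mulrA.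
Qed.

End Frobenius.


(** * Linear maps over a subfield and commutators with multiplications *)

Section LinearMaps.
Local Open Scope ring_scope.
Variable K : fieldType.
Implicit Types (N H : K -> Prop) (T D : K -> K).

Definition linear_over N T : Prop :=
  (forall x y, T (x + y) = T x + T y) /\ (forall a x, N a -> T (a * x) = a * T x).

Definition subspace N H : Prop :=
  [/\ H 0, forall x y, H x -> H y -> H (x + y) & forall a x, N a -> H x -> H (a * x)].

Lemma linear_over_sub N N' T : (forall x, N x -> N' x) ->
  linear_over N' T -> linear_over N T.
Proof. by move=> NN' [TD TZ]; split=> // a x /NN'; apply: TZ. Qed.

Lemma linear_over0 N T : linear_over N T -> T 0 = 0.
Proof. by case=> TD _; apply: (addrI (T 0)); rewrite -TD !addr0. Qed.

Lemma linear_over_sum N T (I : Type) (r : seq I) (P : pred I) (F : I -> K) :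
  linear_over N T -> T (\sum_(i <- r | P i) F i) = \sum_(i <- r | P i) T (F i).
Proof.
by move=> linT; apply: (big_morph T (proj1 linT)); apply: linear_over0 linT.
Qed.

Lemma linear_over_comp N T D :
  linear_over N T -> linear_over N D -> linear_over N (comp_op T D).
Proof.
move=> [TD TZ] [DD DZ]; split=> [x y|a x Na]; rewrite /comp_op.
  by rewrite DD TD.
by rewrite DZ // TZ.
Qed.

Lemma linear_over_add N T D :
  linear_over N T -> linear_over N D -> linear_over N (add_fun T D).
Proof.
move=> [TD TZ] [DD DZ]; split=> [x y|a x Na]; rewrite /add_fun.
  by rewrite DD TD addrACA.
by rewrite DZ // TZ // mulrDr.
Qed.

Lemma linear_over_mul N a : linear_over N (mul_op a).
Proof. by split=> [x y|b x _]; rewrite /mul_op ?mulrDr // mulrCA. Qed.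

(** With this form [iter_comm (b :: bs) D] is convertible to [ad b (iter_comm bs D)]. *)
Definition ad (y : K) (D : K -> K) : K -> K := fun x => y * D x - D (y * x).

Lemma ad_comm a b D : ad a (ad b D) = ad b (ad a D).
Proof. by apply: funext => x; rewrite /ad (mulrCA a b x); ring. Qed.

Lemma ad_zero a : ad a (@zero_fun K) = @zero_fun K.
Proof. by apply: funext => x; rewrite /ad /zero_fun mulr0 subr0. Qed.

Lemma linear_over_ad N a D : linear_over N D -> linear_over N (ad a D).
Proof.
case=> DD DZ; split=> [x y|b x Nb]; rewrite /ad.
  by rewrite mulrDr !DD; ring.
by rewrite (mulrCA a b x) !(DZ b) //; ring.
Qed.

(** Allows the vanishing of a commutator to be tested on a spanning family over [N]. *)
Lemma ad_sub N D : is_subfield N -> linear_over N D ->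
  subspace N (fun y => ad y D = @zero_fun K).
Proof.
move=> sfN linD; split.
- by apply: funext => x; rewrite /ad !mul0r (linear_over0 linD) subr0.
- move=> x y x0 y0; apply: funext => z.
  have := congr1 (fun f => f z) x0; have := congr1 (fun f => f z) y0.
  rewrite /ad /zero_fun !mulrDl (proj1 linD) => /eqP; rewrite subr_eq0 => /eqP ->.
  by move=> /eqP; rewrite subr_eq0 => /eqP ->; rewrite subrr.
- move=> b x Nb x0; apply: funext => z.
  have := congr1 (fun f => f z) x0.
  rewrite /ad /zero_fun -!mulrA (proj2 linD b) // => /eqP; rewrite subr_eq0 => /eqP ->.
  by rewrite subrr.
Qed.

Lemma ad_iter_comm a bs D : ad a (iter_comm bs D) = iter_comm bs (ad a D).
Proof.
elim: bs => [|b bs IHbs] //.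
by rewrite -[LHS]/(ad a (ad b (iter_comm bs D))) ad_comm IHbs.
Qed.

Lemma iter_comm_zero bs : iter_comm bs (@zero_fun K) = @zero_fun K.
Proof.
by elim: bs => [|b bs IHbs] //; rewrite -[LHS]/(ad b (iter_comm bs _)) IHbs ad_zero.
Qed.

Lemma iter_ad_zero n b : iter n (ad b) (@zero_fun K) = @zero_fun K.
Proof. by elim: n => [|n IHn] //=; rewrite IHn ad_zero. Qed.

Lemma iter_comm_nseq n b D : iter_comm (nseq n b) D = iter n (ad b) D.
Proof. by elim: n => [|n IHn] //=; rewrite -IHn. Qed.

(** The operators [ad b] commute, so a word may be sorted, with the letters satisfying [P] applied
    last. *)
Lemma iter_comm_filter (P : pred K) bs D :
  iter_comm bs D = iter_comm (filter P bs) (iter_comm (filter (predC P) bs) D).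
Proof.
elim: bs => [|b bs IHbs] //.
rewrite -[LHS]/(ad b (iter_comm bs D)) IHbs /=; case: (P b) => //=.
by rewrite ad_iter_comm.
Qed.

Lemma linear_over_iter_comm N bs D :
  linear_over N D -> linear_over N (iter_comm bs D).
Proof. by move=> linD; elim: bs => [|b bs IHbs] //; apply: linear_over_ad. Qed.

(* ad y is the difference of the commuting operators "multiply after" and
   "multiply before", encoded by the polynomial y - X. *)
Lemma iter_ad_coef n y D x :
  iter n (ad y) D x = \sum_(i < n.+1) ((y%:P - 'X) ^+ n)`_i * D (y ^+ i * x).
Proof.
elim: n x => [|n IHn] x /=.
  by rewrite big_ord1 expr0 coef1 mul1r mul1r.
rewrite /ad !IHn.
have last0 : ((y%:P - 'X) ^+ n)`_n.+1 = 0.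
  apply: nth_default; apply: leq_trans (size_poly_exp_leq _ _) _.
  by rewrite -opprB size_polyN size_XsubC mul1n.
under [RHS]eq_bigr => i _ do rewrite exprS mulrBl coefB coefCM mulrBl.
rewrite sumrB [X in _ = X - _]big_ord_recr /= last0 mulr0 mul0r addr0.
rewrite [X in _ = _ - X]big_ord_recl coefXM mul0r add0r mulr_sumr.
congr (_ - _); first by apply: eq_bigr => i _; rewrite mulrA.
by apply: eq_bigr => i _; rewrite coefXM /= /bump add1n exprSr mulrA.
Qed.

End LinearMaps.

(** * Linear forms over large subfields, and operators of finite order *)

Section FrobeniusLinear.
Local Open Scope ring_scope.
Variables (K : fieldType) (p : nat).
Hypothesis hp : p \in [pchar K].
Hypothesis finK : frob_finite K p.
Implicit Types (N H A : K -> Prop) (T D : K -> K).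

(** In characteristic p the polynomial (y - X)^(p^m) is y^(p^m) - X^(p^m), so only the two extreme
    terms of [iter_ad_coef] survive. *)
Lemma iter_ad_pexp m y D : iter (p ^ m) (ad y) D = ad (y ^+ (p ^ m)) D.
Proof.
apply: funext => x; rewrite iter_ad_coef.
have -> : (y%:P - 'X) ^+ (p ^ m) = (y ^+ (p ^ m))%:P - 'X^(p ^ m).
  have pn : [pchar {poly K}].-nat (p ^ m)%N.
    by rewrite (eq_pnat _ (@pchar_poly K)) pexp_pnat.
  by rewrite exprDn_pchar // exprNn_pchar // polyC_exp.
under eq_bigr => i _ do rewrite coefB mulrBl.
rewrite sumrB /ad big_ord_recl big_ord_recr /= coefXn eqxx mul1r coefC mul1r.
rewrite big1 ?addr0 => [|i _]; last by rewrite coefC mul0r.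
by rewrite big1 ?add0r => [|i _]; last by rewrite coefXn ltn_eqF ?mul0r.
Qed.

(** [H] is enlarged to a hyperplane [G] with K = G + N y, and [phi] reads off the coefficient of
    [y]. Finiteness over K^(p^m) makes the enlargement a finite induction over a spanning family. *)
Lemma linear_functional m N H y : is_subfield N ->
  (forall x, frob_pow p m x -> N x) -> subspace N H -> ~ H y ->
  exists phi, [/\ linear_over N phi, forall x, N (phi x),
    forall x, H x -> phi x = 0 & phi y = 1].
Proof.
move=> sfN kN subH nHy; have [I [b span_b]] := finK m.
pose good G := [/\ subspace N G, forall x, H x -> G x & ~ G y].
pose complement (G : K -> Prop) z := exists2 n, N n & G (z - n * y).
have N0 := subfield0 sfN; have N1 := subfield1 sfN.
have [G [[G0 GD GZ] HG nGy] Gy] : exists2 G, good G & forall i, complement G (b i).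
  suff [G gG Gs] : exists2 G, good G & forall z, z \in codom b -> complement G z.
    by exists G => // i; apply/Gs/codom_f.
  elim: (codom b) => [|z s [G gG Gs]]; first by exists H.
  have [[G0 GD GZ] HG nGy] := gG.
  have [Gz|nGz] := EM (complement G z).
    by exists G => // z'; rewrite inE => /predU1P[->|/Gs].
  have GG' x : G x -> exists2 n, N n & G (x - n * z).
    by move=> Gx; exists 0 => //; rewrite mul0r subr0.
  (* The enlarged space G + N z still avoids [y]: if y - n z is in [G], then either n = 0 and [y] is
     in [G], or dividing by n puts [z] in G + N y. *)
  exists (fun x => exists2 n, N n & G (x - n * z)).
    split; first split.
    - exact: GG'.
    - move=> x x' [n Nn Gx] [n' Nn' Gx']; exists (n + n'); first exact: subfieldD.
      by rewrite (_ : _ - _ = (x - n * z) + (x' - n' * z)); [apply: GD | ring].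
    - move=> a x Na [n Nn Gx]; exists (a * n); first exact: subfieldM.
      by rewrite (_ : _ - _ = a * (x - n * z)); [apply: GZ | ring].
    - by move=> x /HG /GG'.
    case=> n Nn Gn; have [n0|n0] := eqVneq n 0.
      by apply: nGy; rewrite n0 mul0r subr0 in Gn.
    apply: nGz; exists n^-1; first exact: subfieldV.
    rewrite (_ : _ - _ = - n^-1 * (y - n * z)); last by field.
    by apply: GZ => //; apply: subfieldN => //; apply: subfieldV.
  move=> z'; rewrite inE => /predU1P[->|/Gs[n Nn Gn]].
    by exists 0 => //; exists 1 => //; rewrite (_ : _ - _ = 0) //; ring.
  by exists n => //; apply: GG'.
have decomp x : complement G x.
  have [c ->] := span_b x; elim/big_ind: _.
  - by exists 0 => //; rewrite mul0r subr0.
  - move=> x1 x2 [n1 N1' G1] [n2 N2 G2]; exists (n1 + n2); first exact: subfieldD.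
    by rewrite (_ : _ - _ = (x1 - n1 * y) + (x2 - n2 * y)); [apply: GD | ring].
  move=> i _; have [n Nn Gn] := Gy i.
  have Nc : N (c i ^+ (p ^ m)) by apply: kN; exists (c i).
  exists (c i ^+ (p ^ m) * n); first exact: subfieldM.
  by rewrite -mulrA -mulrBr; apply: GZ.
have uniq x n n' : N n -> N n' -> G (x - n * y) -> G (x - n' * y) -> n = n'.
  move=> Nn Nn' Gn Gn'; apply/eqP; rewrite -subr_eq0; apply/negP => /negP n0.
  apply: nGy; rewrite (_ : y = (n - n')^-1 * ((x - n' * y) + (-1) * (x - n * y))).
    apply: (GZ); first by apply: subfieldV => //; apply: subfieldB.
    by apply: GD => //; apply: GZ => //; apply: subfieldN.
  by field.
have /choice[phi phiP] : forall x, exists n, N n /\ G (x - n * y).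
  by move=> x; have [n] := decomp x; exists n.
have phiN x := (phiP x).1; have phiG x := (phiP x).2.
exists phi; split=> //; first split.
- move=> x x'; apply: (uniq (x + x')) => //; first exact: subfieldD.
  by rewrite (_ : _ - _ = (x - phi x * y) + (x' - phi x' * y)); [apply: GD | ring].
- move=> a x Na; apply: (uniq (a * x)) => //; first exact: subfieldM.
  by rewrite -mulrA -mulrBr; apply: GZ.
- by move=> x Hx; apply: (uniq x) => //; rewrite mul0r subr0; apply: HG.
by apply: (uniq y) => //; rewrite mul1r subrr.
Qed.

(** Such a [phi] commutes with [N] but not with [y], as y phi(1) = 0 and phi(y) = 1. It separates
    [y] from [N] in every commutant argument below. *)
Lemma linear_detect m N y : is_subfield N -> (forall x, frob_pow p m x -> N x) ->
  ~ N y -> exists phi, [/\ linear_over N phi, forall x, N (phi x),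
    phi 1 = 0 & phi y = 1].
Proof.
move=> sfN kN nNy.
have subN : subspace N N.
  by split; [exact: subfield0 | exact: subfieldD | exact: subfieldM].
have [phi [lin_phi N_phi phi0 phi1]] := linear_functional sfN kN subN nNy.
by exists phi; split=> //; apply: phi0; apply: subfield1.
Qed.

(** If n + 1 commutators kill [D], then so do p^(n+1) of them, because n + 1 <= p^(n+1). By
    [iter_ad_pexp], [D] then commutes with every p^(n+1)-th power. *)
Lemma diffop_frob_linear A D : is_diffop A (@fullK K) D ->
  exists m, linear_over (frob_pow p m) D.
Proof.
case=> _ _ DD _ [n Dn]; exists n.+1; split=> [x y|a x [y ->]]; first exact: DD.
have := iter_ad_pexp n.+1 y D.
have n_lt : (n.+1 <= p ^ n.+1)%N.
  by apply/ltnW/ltn_expl/prime_gt1; apply: pcharf_prime hp.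
rewrite -{1}(subnK n_lt) iterD -[iter n.+1 _ _]iter_comm_nseq Dn ?size_nseq //.
rewrite iter_ad_zero => /(congr1 (fun f => f x)) /esym /eqP.
by rewrite /ad /zero_fun subr_eq0 => /eqP ->.
Qed.

(** Pigeonhole on a finite alphabet: a long word has either enough letters other than [b] for the
    induction hypothesis, or p^m letters [b], whose commutators amount to one with b^(p^m) and
    vanish by linearity. *)
Lemma iter_comm_words m (g : seq K) : exists n, forall bs D, (n <= size bs)%N ->
  {subset bs <= g} -> linear_over (frob_pow p m) D -> iter_comm bs D = @zero_fun K.
Proof.
elim: g => [|b g [n IHg]].
  exists 1%N => -[|c bs] D // _ sub_bs _.
  by have := sub_bs c (mem_head _ _).
exists (n + p ^ m)%N => bs D le_n sub_bs linD.
rewrite (iter_comm_filter (pred1 b)).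
set bs1 := filter (pred1 b) bs; set bs2 := filter _ bs.
have size_bs : (size bs1 + size bs2 = size bs)%N by rewrite !size_filter count_predC.
have [le2|lt2] := leqP n (size bs2).
  rewrite [iter_comm bs2 D]IHg ?iter_comm_zero // => z.
  rewrite mem_filter => /andP[/= zb /sub_bs]; rewrite inE => /predU1P[zb'|//].
  by rewrite zb' eqxx in zb.
have -> : bs1 = nseq (size bs1) b by apply/all_pred1P/filter_all.
have le1 : (p ^ m <= size bs1)%N by lia.
rewrite iter_comm_nseq -(subnK le1) iterD iter_ad_pexp.
rewrite (_ : ad _ _ = @zero_fun K) ?iter_ad_zero //; apply: funext => x.
rewrite /ad /zero_fun; have [_ ->] := linear_over_iter_comm bs2 linD; last by exists b.
by rewrite subrr.
Qed.

(** [iter_comm_words] bounds the order for letters from a spanning family. Arbitrary letters are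
    then replaced one at a time, since a commutator is linear over K^(p^m) in its letter. *)
Lemma frob_linear_order m D : linear_over (frob_pow p m) D ->
  exists n, forall bs, size bs = n.+1 -> iter_comm bs D = @zero_fun K.
Proof.
move=> linD; have [I [b span_b]] := finK m.
have [n words0] := iter_comm_words m (codom b); exists n => bs.
have: forall ws, size ws = n.+1 -> {subset ws <= codom b} ->
  iter_comm ws D = @zero_fun K.
  by move=> ws size_ws sub_ws; apply: words0; rewrite // size_ws.
(* The first letter [c] is absorbed into the operator, which becomes [ad c D]; hence [D] must vary
   in the induction. *)
elim: n.+1 bs D linD {words0} => [|k IHk] bs D linD words0.
  by move=> /size0nil ->; apply: (words0 [::]).
case: bs => [|c bs] // [size_bs].
rewrite -[LHS]/(ad c (iter_comm bs D)) ad_iter_comm.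
apply: IHk => //; first exact: linear_over_ad.
move=> ws size_ws sub_ws; rewrite -ad_iter_comm.
have [E0 ED EZ] := ad_sub (frob_pow_subfield hp m) (linear_over_iter_comm ws linD).
have [d ->] := span_b c; elim/big_ind: _ => // i _.
apply: EZ; first by exists (d i).
apply: (words0 (b i :: ws)); first by rewrite /= size_ws.
by move=> z; rewrite inE => /predU1P[->|/sub_ws //]; apply: codom_f.
Qed.

(** Over a field containing some K^(p^m) the finite order condition is automatic, so from here on
    operators are handled as linear maps. *)
Lemma is_diffop_linear m A D : (forall x, frob_pow p m x -> A x) ->
  is_diffop A (@fullK K) D <-> linear_over A D.
Proof.
move=> kA; split=> [[_ _ DD DZ _]|[DD DZ]].
  by split=> [x y|a x Aa]; [apply: DD | apply: DZ].
have [n Dn] := @frob_linear_order m D (conj DD (fun a x ka => DZ a x (kA a ka))).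
split=> // [x /(_ I) //|a x Aa _|]; first exact: DZ.
by exists n => bs size_bs _; apply: Dn.
Qed.

End FrobeniusLinear.


(** * Dual bases in spaces of maps *)

Section DualSystems.
Local Open Scope ring_scope.
Variables (K : fieldType) (F : K -> Prop) (V : (K -> K) -> Prop).

(** Families are indexed by [nat] and read only below [r], which makes it easy to append an
    element. *)
Definition dual_system r (b : nat -> K -> K) (x : nat -> K) : Prop :=
  [/\ forall i, (i < r)%N -> V (b i), forall i, (i < r)%N -> F (x i) &
      forall i j, (i < r)%N -> (j < r)%N -> b i (x j) = (i == j)%:R].

Hypothesis sfF : is_subfield F.
Hypothesis VD : forall D E, V D -> V E -> V (add_fun D E).
Hypothesis VZ : forall a D, F a -> V D -> V (scale_fun a D).

Lemma span_closed r (b : nat -> K -> K) (c : nat -> K) E :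
  (forall i, (i < r)%N -> V (b i)) -> (forall i, (i < r)%N -> F (c i)) -> V E ->
  V (fun y => E y + \sum_(i < r) c i * b i y).
Proof.
move=> Vb Fc VE; elim: r Vb Fc => [|r IHr] Vb Fc.
  by rewrite [X in V X](_ : _ = E) //; apply: funext => y; rewrite big_ord0 addr0.
have -> : (fun y => E y + \sum_(i < r.+1) c i * b i y) =
    add_fun (fun y => E y + \sum_(i < r) c i * b i y) (scale_fun (c r) (b r)).
  by apply: funext => y; rewrite /add_fun /scale_fun big_ord_recr /= addrA.
apply: VD; last by apply: VZ; [apply: Fc | apply: Vb].
by apply: IHr => i ltir; [apply: Vb | apply: Fc]; apply: leqW.
Qed.

Hypothesis Vin : forall E y, V E -> F y -> F (E y).
Hypothesis Vout : forall E y, V E -> ~ F y -> E y = 0.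

(** A dual system that fails to expand some [E] can be lengthened by one. If none expanded all of
    [V], lengthening from the empty system would exceed the bound [N]. *)
Lemma dual_basis N : (forall r b x, dual_system r b x -> (r <= N)%N) ->
  exists r b x, dual_system r b x /\
    forall E, V E -> forall y, E y = \sum_(i < r) E (x i) * b i y.
Proof.
move=> boundN; apply: contrapT => no_basis.
have [r lt_Nr [b [x /boundN]]] : exists2 r, (N < r)%N & exists b x, dual_system r b x.
  exists N.+1 => //; elim: N.+1 => [|r [b [x sys]]].
    by exists (fun _ _ => 0), (fun _ => 0).
  have [Vb Fx bx] := sys.
  have [E [VE [y Ey]]] : exists E, V E /\
      exists y, E y != \sum_(i < r) E (x i) * b i y.
    apply: contrapT => allE; apply: no_basis; exists r, b, x; split=> // E VE y.
    apply/eqP; apply: contrapT => /negP nE.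
    by apply: allE; exists E; split=> //; exists y.
  (* The error of the expansion vanishes at all old points but not at [y]. Normalised to [E2], it is
     the new map; subtracting [b i y] times [E2] makes each old [b i] vanish at the new point
     [y]. *)
  pose E1 z := E z + \sum_(i < r) - E (x i) * b i z.
  have VE1 : V E1.
    apply: (@span_closed r b (fun i => - E (x i))) => // i ltir; apply: subfieldN => //.
    by apply: Vin => //; apply: Fx.
  have E1x j : (j < r)%N -> E1 (x j) = 0.
    move=> ltjr; rewrite /E1 (bigD1 (Ordinal ltjr)) //= bx // eqxx mulr1 big1.
      by rewrite addr0 subrr.
    by move=> i ne_ij; rewrite bx // (negPf ne_ij : (i == j :> nat) = false) mulr0.
  have E1y : E1 y != 0.
    rewrite /E1; under eq_bigr => i _ do rewrite mulNr.
    by rewrite sumrN subr_eq0.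
  have Fy : F y by apply: contrapT => nFy; rewrite (Vout VE1) ?eqxx in E1y.
  pose E2 := scale_fun (E1 y)^-1 E1.
  have VE2 : V E2 by apply: VZ => //; apply: subfieldV => //; apply: Vin.
  have E2x j : (j < r)%N -> E2 (x j) = 0.
    by move=> /E1x; rewrite /E2 /scale_fun => ->; rewrite mulr0.
  have E2y : E2 y = 1 by rewrite /E2 /scale_fun mulVf.
  exists (fun i => if i == r then E2 else add_fun (b i) (scale_fun (- b i y) E2)).
  exists (fun i => if i == r then y else x i).
  split=> [i|i|i j]; rewrite !ltnS.
  - rewrite leq_eqVlt; case: eqP => //= _ ltir.
    apply: VD; [exact: Vb | apply: VZ => //].
    by apply: subfieldN => //; apply: Vin => //; apply: Vb.
  - by rewrite leq_eqVlt; case: eqP => //= _; apply: Fx.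
  rewrite /add_fun /scale_fun leq_eqVlt; case: eqP => [->|/eqP ne_ir] /=.
    rewrite leq_eqVlt; case: eqP => [->|/eqP ne_jr] /=; first by rewrite eqxx.
    by move=> _ ltjr; rewrite E2x // eq_sym (negPf ne_jr).
  move=> ltir; rewrite leq_eqVlt; case: eqP => [->|_] /=.
    by rewrite E2y mulr1 subrr (negPf ne_ir).
  by move=> ltjr; rewrite E2x // mulr0 addr0 bx.
by rewrite leqNgt lt_Nr.
Qed.

End DualSystems.

(** * Bounded dual systems and the Jacobson-Bourbaki theorem *)

Section FrobeniusDual.
Local Open Scope ring_scope.
Variables (K : fieldType) (p : nat).
Hypothesis hp : p \in [pchar K].
Hypothesis finK : frob_finite K p.
Implicit Types (F A W : K -> Prop) (V : (K -> K) -> Prop) (T D E : K -> K).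

(** Too many points x_j satisfy a nontrivial relation over K^(p^m), and applying b_i to it isolates
    its i-th coefficient. *)
Lemma dual_system_bounded m F V : is_subfield F ->
  (forall x, frob_pow p m x -> F x) ->
  (forall E x y, V E -> F x -> F y -> E (x + y) = E x + E y) ->
  (forall E a x, V E -> frob_pow p m a -> F x -> E (a * x) = a * E x) ->
  exists N, forall r b x, dual_system F V r b x -> (r <= N)%N.
Proof.
move=> sfF kF VD VZ; have [I [b0 span_b0]] := finK m.
exists #|I| => r b x [Vb Fx bx]; rewrite leqNgt; apply/negP => ltIr.
have [v v0 [i ltir]] := frob_dependent hp x span_b0 ltIr; case/eqP.
have kv j : frob_pow p m (v j ^+ (p ^ m)) by exists (v j).
have E0 : b i 0 = 0.
  have F0 := subfield0 sfF.
  by apply: (addrI (b i 0)); rewrite -VD ?addr0 //; apply: Vb.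
have [_ +] : F (\sum_(j < r) v j ^+ (p ^ m) * x j) /\
    b i (\sum_(j < r) v j ^+ (p ^ m) * x j) = \sum_(j < r) v j ^+ (p ^ m) * b i (x j).
  elim/big_ind2: _ => [|x1 y1 x2 y2 [F1 E1] [F2 E2]|j _].
  - by split=> //; apply: subfield0.
  - by split; [apply: subfieldD | rewrite VD ?E1 ?E2 //; apply: Vb].
  split; first by apply: subfieldM => //; [apply: kF | apply: Fx].
  by rewrite VZ //; [apply: Vb | apply: Fx].
rewrite v0 E0 (bigD1 (Ordinal ltir)) //= bx // eqxx mulr1 big1 ?addr0 => [|j ne_ji].
  by move=> /esym /eqP; rewrite expf_eq0 => /andP[_ /eqP].
by rewrite bx // eq_sym (negPf ne_ji : (j == i :> nat) = false) mulr0.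
Qed.

Definition commutant V : K -> Prop :=
  fun x => forall E, V E -> forall y, x * E y = E (x * y).

(* In a dual basis (b_i, x_i) of V, the operator E a b_j has coordinates
   E(a) delta_ij, so E(a b_j(y)) = E(a) b_j(y): every b_j takes its values in
   the commutant W. Hence y = sum b_i(y) x_i expands y over W, and a W-linear T
   equals sum T(x_i) b_i. *)
Theorem jacobson_bourbaki m V T :
  (forall a, V (mul_op a)) -> (forall D E, V D -> V E -> V (add_fun D E)) ->
  (forall D E, V D -> V E -> V (comp_op D E)) ->
  (forall E, V E -> linear_over (frob_pow p m) E) ->
  linear_over (commutant V) T -> V T.
Proof.
move=> Vmul VD Vcomp Vlin [TD TZ].
have VZ a D : fullK a -> V D -> V (scale_fun a D).
  by move=> _; apply: (Vcomp (mul_op a)) (Vmul a).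
have sfT := fullK_subfield K.
have [N boundN] : exists N, forall r b x,
    dual_system (@fullK K) V r b x -> (r <= N)%N.
  apply: (@dual_system_bounded m) => // [E x y /Vlin[+ _]|E a x /Vlin[_ +] ka _].
    by move=> ED _ _; apply: ED.
  exact.
have Vout E y : V E -> ~ fullK y -> E y = 0 by move=> _ [].
have [r [b [x [[Vb _ bx] basis]]]] :=
  dual_basis sfT VD VZ (fun _ _ _ _ => I) Vout boundN.
have E0 E : V E -> E 0 = 0 by move=> /Vlin /linear_over0.
have Eb E a j y : V E -> (j < r)%N -> E (a * b j y) = E a * b j y.
  move=> VE ltjr.
  have := basis (comp_op E (comp_op (mul_op a) (b j))).
  rewrite /comp_op /mul_op => -> ; last exact: Vcomp VE (Vcomp _ _ (Vmul a) (Vb _ ltjr)).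
  rewrite (bigD1 (Ordinal ltjr)) //= bx // eqxx mulr1 big1 ?addr0 // => i ne_ij.
  by rewrite bx // eq_sym (negPf ne_ij : (i == j :> nat) = false) mulr0 E0 // mul0r.
have Wb j y : (j < r)%N -> commutant V (b j y).
  by move=> ltjr E VE z; rewrite [in RHS]mulrC Eb // mulrC.
have T0 : T 0 = 0 by apply: (addrI (T 0)); rewrite -TD !addr0.
have -> : T = fun y => mul_op 0 y + \sum_(i < r) T (x i) * b i y.
  apply: funext => y; rewrite /mul_op mul0r add0r.
  have := basis (mul_op 1) (Vmul 1) y; rewrite /mul_op mul1r => {1}->.
  rewrite (big_morph T TD T0); apply: eq_bigr => i _.
  by rewrite mul1r mulrC TZ 1?mulrC //; apply: Wb.
exact: (@span_closed _ (@fullK K) V VD VZ r b (fun i => T (x i))).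
Qed.

End FrobeniusDual.


(** * Derivations, their iterates and their kernels *)

Section Derivations.
Local Open Scope ring_scope.
Variables (K : fieldType) (p : nat).
Hypothesis hp : p \in [pchar K].
Implicit Types (F A : K -> Prop) (L : (K -> K) -> Prop) (D E : K -> K).

(** Weaker than [is_derivation]: values may leave [F] and nothing is asked outside [F]. Restrictions
    to smaller fields and combinations with coefficients in [K] thus still qualify. *)
Definition derives F D : Prop :=
  (forall x y, F x -> F y -> D (x + y) = D x + D y) /\
  (forall x y, F x -> F y -> D (x * y) = x * D y + y * D x).

Lemma derivation_derives F D : is_derivation F D -> derives F D.
Proof. by case=> _ _ DD DM; split. Qed.

Section OneDerivation.
Variables (F : K -> Prop) (D : K -> K).
Hypotheses (sfF : is_subfield F) (derD : derives F D).

Lemma der0 : D 0 = 0.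
Proof.
have F0 := subfield0 sfF.
by apply: (addrI (D 0)); rewrite -(proj1 derD) // !addr0.
Qed.

Lemma der1 : D 1 = 0.
Proof.
have F1 := subfield1 sfF.
by apply: (addrI (D 1)); rewrite addr0 -[in RHS](mulr1 1) (proj2 derD) // !mul1r.
Qed.

Lemma derZ a x : F a -> D a = 0 -> F x -> D (a * x) = a * D x.
Proof. by move=> Fa Da Fx; rewrite (proj2 derD) // Da mulr0 addr0. Qed.

Lemma derN x : F x -> D (- x) = - D x.
Proof.
move=> Fx; apply: (addrI (D x)).
by rewrite -(proj1 derD) ?subrr ?der0 //; apply: subfieldN.
Qed.

Lemma der_sum n (f : nat -> K) : (forall i, (i < n)%N -> F (f i)) ->
  D (\sum_(i < n) f i) = \sum_(i < n) D (f i).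
Proof.
elim: n => [|n IHn] Ff; first by rewrite !big_ord0 der0.
have Ff' i : (i < n)%N -> F (f i) by move=> ltin; apply/Ff/leqW.
rewrite !big_ord_recr /= (proj1 derD) ?IHn //; last exact: Ff.
by apply: subfield_sum => // i _; apply: Ff'.
Qed.

Lemma derMn x n : F x -> D (x *+ n) = D x *+ n.
Proof.
move=> Fx; elim: n => [|n IHn]; first by rewrite !mulr0n der0.
rewrite !mulrS (proj1 derD) ?IHn // -mulr_natl.
by apply: subfieldM => //; apply: subfield_nat.
Qed.

Lemma derX x n : F x -> D (x ^+ n) = n%:R * x ^+ n.-1 * D x.
Proof.
move=> Fx; elim: n => [|[|n] IHn]; first by rewrite expr0 der1 !mul0r.
  by rewrite expr1 expr0 !mul1r.
rewrite exprS (proj2 derD) ?IHn //=; last exact: subfieldX.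
by rewrite exprS -[n.+2%:R]/(1 + n.+1%:R); ring.
Qed.

Lemma der_pth x : F x -> D (x ^+ p) = 0.
Proof. by move=> Fx; rewrite derX // (pcharf0 hp) !mul0r. Qed.

Lemma der_kernel_subfield : is_subfield (fun x => F x /\ D x = 0).
Proof.
have F0 := subfield0 sfF; have F1 := subfield1 sfF.
split; first by split; [|exact: der0].
split; first by split; [|exact: der1].
split.
  move=> x y [Fx Dx] [Fy Dy]; split; first exact: subfieldD.
  by rewrite (proj1 derD) // Dx Dy addr0.
split; first by move=> x [Fx Dx]; rewrite derN // Dx oppr0; split=> //; apply: subfieldN.
split.
  move=> x y [Fx Dx] [Fy Dy]; split; first exact: subfieldM.
  by rewrite derZ // Dy mulr0.
move=> x [Fx Dx]; have Fx' := subfieldV sfF Fx; split=> //.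
have [->|x0] := eqVneq x 0; first by rewrite invr0 der0.
by apply: (mulfI x0); rewrite -derZ // mulfV // mulr0 der1.
Qed.

Hypothesis FD : forall x, F x -> F (D x).

Lemma iter_der_in n x : F x -> F (iter n D x).
Proof. by move=> Fx; elim: n => //= n; apply: FD. Qed.

Lemma iter_derD n x y : F x -> F y -> iter n D (x + y) = iter n D x + iter n D y.
Proof.
move=> Fx Fy; elim: n => //= n ->.
by rewrite (proj1 derD) //; apply: iter_der_in.
Qed.

Lemma iter_derM n x y : F x -> F y -> iter n D (x * y) =
  \sum_(i < n.+1) (iter i D x * iter (n - i) D y) *+ 'C(n, i).
Proof.
move=> Fx Fy; elim: n => [|n IHn]; first by rewrite big_ord1 subn0 bin0 mulr1n.
have Fi i := iter_der_in i Fx; have Fj i := iter_der_in i Fy.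
rewrite iterS IHn.
rewrite (der_sum (f := fun i => (iter i D x * iter (n - i) D y) *+ 'C(n, i)));
  last first.
  move=> i _; rewrite -mulr_natl; apply: subfieldM => //; first exact: subfield_nat.
  exact: subfieldM.
have -> : \sum_(i < n.+1) D ((iter i D x * iter (n - i) D y) *+ 'C(n, i)) =
    \sum_(i < n.+1) ((iter i D x * iter (n.+1 - i) D y) *+ 'C(n, i) +
    (iter i.+1 D x * iter (n.+1 - i.+1) D y) *+ 'C(n, i)).
  apply: eq_bigr => i _; rewrite derMn; last exact: subfieldM.
  rewrite (proj2 derD) // -mulrnDl subSS subSn; last by rewrite -ltnS.
  by rewrite !iterS [X in _ + X]mulrC.
rewrite big_split big_ord_recl [RHS]big_ord_recl /= !bin0 -addrA; congr (_ + _).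
have -> : \sum_(i < n) (iter (bump 0 i) D x * iter (n.+1 - bump 0 i) D y)
      *+ 'C(n, bump 0 i) =
    \sum_(i < n.+1) (iter i.+1 D x * iter (n.+1 - i.+1) D y) *+ 'C(n, i.+1).
  by rewrite big_ord_recr /= bin_small // mulr0n addr0.
by rewrite -big_split; apply: eq_bigr => i _; rewrite /= -mulrnDr.
Qed.

Lemma iter_pth_derM x y : F x -> F y ->
  iter p D (x * y) = x * iter p D y + y * iter p D x.
Proof.
move=> Fx Fy; rewrite iter_derM //.
case: (p) (pchar_gt0 hp) (bin_lt_pcharf_0 hp) => // n _ bin0p.
rewrite big_ord_recr big_ord_recl /= ?subn0 subnn bin0 binn.
rewrite big1 ?addr0 => [|i _]; first by rewrite [X in _ + X]mulrC.
by rewrite -mulr_natr bin0p ?mulr0 //= /bump add1n /= ltnS.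
Qed.

Lemma iter_derZ n a x : F a -> D a = 0 -> F x -> iter n D (a * x) = a * iter n D x.
Proof.
move=> Fa Da Fx; elim: n => //= n ->.
by rewrite derZ //; apply: iter_der_in.
Qed.

End OneDerivation.

Lemma p_lie_rel_der F A : is_subfield F -> p_lie p F (rel_der F A).
Proof.
move=> sfF; have F0 := subfield0 sfF.
have d0 D : is_derivation F D -> D 0 = 0.
  by move=> /derivation_derives /(der0 sfF).
split; first split.
- by move=> D [].
- by split=> //; split=> // *; rewrite /zero_fun ?mulr0 addr0.
- move=> D E [[Dout Din DD DM] DA] [[Eout Ein ED EM] EA]; split; last first.
    by move=> x Ax; rewrite /add_fun DA // EA // addr0.
  split; rewrite /add_fun.
  + by move=> x nFx; rewrite Dout // Eout // addr0.
  + by move=> x Fx; apply: subfieldD; [| apply: Din | apply: Ein].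
  + by move=> x y Fx Fy; rewrite DD // ED //; ring.
  + by move=> x y Fx Fy; rewrite DM // EM //; ring.
- move=> a D Fa [[Dout Din DD DM] DA]; split; last first.
    by move=> x Ax; rewrite /scale_fun DA // mulr0.
  split; rewrite /scale_fun.
  + by move=> x nFx; rewrite Dout // mulr0.
  + by move=> x Fx; apply: subfieldM => //; apply: Din.
  + by move=> x y Fx Fy; rewrite DD //; ring.
  + by move=> x y Fx Fy; rewrite DM //; ring.
- move=> D E [dD DA] [dE EA]; have [Dout Din DD DM] := dD.
  have [Eout Ein ED EM] := dE; split; last first.
    by move=> x Ax; rewrite /lie_br (DA x) // (EA x) // (d0 D) // (d0 E) // subrr.
  split; rewrite /lie_br.
  + by move=> x nFx; rewrite (Dout x) // (Eout x) // (d0 D) // (d0 E) // subrr.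
  + by move=> x Fx; apply: subfieldB => //; [apply/Din/Ein | apply/Ein/Din].
  + move=> x y Fx Fy; have Dx := Din _ Fx; have Dy := Din _ Fy.
    have Ex := Ein _ Fx; have Ey := Ein _ Fy.
    by rewrite (ED x y) // (DD x y) // (DD (E x)) // (ED (D x)) //; ring.
  + move=> x y Fx Fy; have Dx := Din _ Fx; have Dy := Din _ Fy.
    have Ex := Ein _ Fx; have Ey := Ein _ Fy.
    have M1 := subfieldM sfF Fx Ey; have M2 := subfieldM sfF Fy Ex.
    have M3 := subfieldM sfF Fx Dy; have M4 := subfieldM sfF Fy Dx.
    rewrite (EM x y) // (DM x y) // (DD (x * E y)) // (ED (x * D y)) //.
    by rewrite (DM x) // (DM y) // (EM x) // (EM y) //; ring.
- move=> D [dD DA]; have [Dout Din DD DM] := dD.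
  have Dp0 x : D x = 0 -> pth_pow p D x = 0.
    rewrite /pth_pow -(prednK (pchar_gt0 hp)) iterSr => ->.
    by elim: p.-1 => //= n ->; apply: d0.
  have derD := derivation_derives dD.
  split; last by move=> x Ax; apply/Dp0/DA.
  split.
  + by move=> x nFx; apply/Dp0/Dout.
  + by move=> x Fx; apply: iter_der_in.
  + by move=> x y Fx Fy; apply: (iter_derD derD).
  + by move=> x y Fx Fy; apply: (iter_pth_derM sfF derD).
Qed.

Lemma Ann_subfield F L : is_subfield F -> (forall D, L D -> derives F D) ->
  is_subfield (Ann F L).
Proof.
move=> sfF derL; have ker D (LD : L D) := der_kernel_subfield sfF (derL D LD).
split.
  by split=> [|D /ker /subfield0 []] //; apply: subfield0.
split; first by split=> [|D /ker /subfield1 []] //; apply: subfield1.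
split.
  move=> x y [Fx Lx] [Fy Ly]; split=> [|D LD]; first exact: subfieldD.
  by have [] := subfieldD (ker D LD) (conj Fx (Lx D LD)) (conj Fy (Ly D LD)).
split.
  move=> x [Fx Lx]; split=> [|D LD]; first exact: subfieldN.
  by have [] := subfieldN (ker D LD) (conj Fx (Lx D LD)).
split.
  move=> x y [Fx Lx] [Fy Ly]; split=> [|D LD]; first exact: subfieldM.
  by have [] := subfieldM (ker D LD) (conj Fx (Lx D LD)) (conj Fy (Ly D LD)).
move=> x [Fx Lx]; split=> [|D LD]; first exact: subfieldV.
by have [] := subfieldV (ker D LD) (conj Fx (Lx D LD)).
Qed.

Lemma natr_lt_pchar n : (n.+1 < p)%N -> n.+1%:R != 0 :> K.
Proof. by move=> lt_np; rewrite -(dvdn_pcharf hp) gtnNdvd. Qed.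

(** * Taylor expansion along a derivation with D x = 1 *)

Section Taylor.
Variables (F : K -> Prop) (D : K -> K) (x : K).
Hypotheses (sfF : is_subfield F) (derD : derives F D) (Fx : F x) (Dx : D x = 1).

Let ker := fun y => F y /\ D y = 0.

Lemma der_polynomial n (c : nat -> K) : (forall i, ker (c i)) ->
  D (\sum_(i < n.+1) c i * x ^+ i) = \sum_(i < n) (i.+1%:R * c i.+1) * x ^+ i.
Proof.
move=> kc; have FX i := subfieldX sfF i Fx.
have Fc i : F (c i) by case: (kc i).
have Dc i : D (c i) = 0 by case: (kc i).
rewrite (der_sum sfF derD (f := fun i => c i * x ^+ i)) => [|i _]; last first.
  exact: subfieldM.
rewrite big_ord_recl (derZ derD) //.
rewrite expr0 (der1 sfF derD) mulr0 add0r; apply: eq_bigr => i _.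
rewrite (derZ derD) // (derX sfF derD) // Dx.
by rewrite /= add0n /bump add1n; ring.
Qed.

(** Applying [D] to a relation gives a shorter one with coefficients (i+1) c_(i+1), where i + 1 < p
    is invertible. *)
Lemma powers_independent n (c : nat -> K) : (n <= p)%N -> (forall i, ker (c i)) ->
  \sum_(i < n) c i * x ^+ i = 0 -> forall i, (i < n)%N -> c i = 0.
Proof.
elim: n c => [|n IHn] c lenp kc // sum0.
have c0 i : (i < n)%N -> c i.+1 = 0.
  move=> ltin; apply/eqP.
  have : i.+1%:R * c i.+1 = 0.
    apply: (IHn (fun i => i.+1%:R * c i.+1)) => // [||].
    - exact: ltnW.
    - move=> j; rewrite /ker; have sfk := der_kernel_subfield sfF derD.
      exact: (subfieldM sfk (subfield_nat sfk _) (kc _)).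
    - by rewrite -der_polynomial // sum0 (der0 sfF derD).
  move=> /eqP; rewrite mulf_eq0 => /orP[|//].
  by rewrite (negPf (natr_lt_pchar _)) // (leq_trans _ lenp) // !ltnS.
case=> [_|i]; last exact: c0.
move: sum0; rewrite big_ord_recl mulr1 big1 ?addr0 // => i _.
by rewrite /= /bump add1n c0 // mul0r.
Qed.

Lemma der_adj_const N z : (forall y, N y -> ker y) ->
  adj N p x z -> D z = 0 -> N z.
Proof.
move=> Nker [c Nc ->].
have kc i := Nker _ (Nc i).
rewrite -(prednK (pchar_gt0 hp)) der_polynomial // => D0.
rewrite big_ord_recl mulr1 big1 ?addr0 // => i _.
have : i.+1%:R * c i.+1 = 0.
  apply: (@powers_independent p.-1 (fun i => i.+1%:R * c i.+1)) => //.
    exact: leq_pred.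
  move=> j; have sfk := der_kernel_subfield sfF derD.
  exact: (subfieldM sfk (subfield_nat sfk _) (kc _)).
move=> /eqP; rewrite mulf_eq0 (negPf (natr_lt_pchar _)).
  by move=> /eqP c0; rewrite lift0 c0 mul0r.
by rewrite -{2}(prednK (pchar_gt0 hp)) ltnS.
Qed.

Hypothesis FD : forall y, F y -> F (D y).
Hypothesis Dp : forall y, F y -> iter p D y = 0.

(** If D^(n+1) f = 0, then g = D^n f is a constant of [D], and subtracting g x^n / n! from [f]
    leaves an element killed by D^n. *)
Lemma taylor f : F f -> adj ker p x f.
Proof.
have iter_fact n : iter n D (x ^+ n) = n`!%:R.
  elim: n => [|n IHn] //.
  rewrite iterSr (derX sfF derD) // Dx mulr1 /=.
  have Dn : D n.+1%:R = 0.
    by have := derMn sfF derD n.+1 (subfield1 sfF); rewrite (der1 sfF derD) mul0rn.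
  rewrite (iter_derZ derD FD) ?IHn ?factS ?natrM //; last exact: subfieldX.
  exact: subfield_nat.
have fact0 n : (n < p)%N -> n`!%:R != 0 :> K.
  elim: n => [|n IHn] lt_np; first by rewrite oner_eq0.
  by rewrite factS natrM mulf_neq0 ?IHn ?natr_lt_pchar // ltnW.
(* The generalised claim is that D^n f = 0 with n <= p makes [f] a polynomial of degree below n; n
   <= p keeps the factorials invertible. *)
move=> Ff; move: (leqnn p) (Dp Ff); move: {1 3 4}p => n.
elim: n f Ff => [|n IHn] f Ff len Dnf.
  rewrite -[f]/(iter 0 D f) Dnf; exists (fun=> 0); last by rewrite big_ord0.
  by move=> _; split; [apply: subfield0 | apply: (der0 sfF)].
set g := iter n D f in Dnf.
have kg : ker g by split=> //; apply: iter_der_in.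
have sfk := der_kernel_subfield sfF derD.
have kgn : ker (- (n`!%:R)^-1 * g).
  exact: (subfieldM sfk (subfieldN sfk (subfieldV sfk (subfield_nat sfk _))) kg).
have Fxn := subfieldX sfF n Fx.
have Fgx : F (- (n`!%:R)^-1 * g * x ^+ n) by apply: subfieldM => //; case: kgn.
have [|||c kc fE] := IHn (f + - (n`!%:R)^-1 * g * x ^+ n).
- exact: subfieldD.
- exact: ltnW.
- rewrite (iter_derD derD FD) // (iter_derZ derD FD) //; try by case: kgn.
  by rewrite iter_fact -/g; field; apply: fact0.
exists (fun i => if i == n then (n`!%:R)^-1 * g else c i).
  move=> i; case: eqP => // _; rewrite -[_ * g]opprK -mulNr.
  exact: (subfieldN sfk).
rewrite big_ord_recr /= eqxx.
under eq_bigr => i _ do rewrite ltn_eqF //.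
by rewrite -fE; ring.
Qed.

End Taylor.

End Derivations.


(** * Jacobson's theorem for extensions of exponent one *)

Section ExponentOne.
Local Open Scope ring_scope.
Variables (K : fieldType) (p : nat).
Hypothesis hp : p \in [pchar K].
Hypothesis finK : frob_finite K p.
Implicit Types (F A N M S : K -> Prop) (L : (K -> K) -> Prop) (D E : K -> K).

(** A chain descending from [F] to [A] in which 1, x_j, ..., x_j^(p-1) is a basis of each field over
    the next. It records both that the x_j generate [F] over [A] and that the degree is p^r. *)
Definition exponent_one_tower r F A (x : nat -> K) : Prop :=
  exists G : nat -> K -> Prop, [/\ G 0%N = F, G r = A &
    forall j, (j < r)%N -> [/\ is_subfield (G j.+1), forall y, G j.+1 y -> G j y,
      G j (x j), forall y, G j y -> adj (G j.+1) p (x j) y &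
      forall c : nat -> K, (forall i, G j.+1 (c i)) ->
        \sum_(i < p) c i * x j ^+ i = 0 -> forall i, (i < p)%N -> c i = 0]].

Lemma exponent_one_tower_min r F A x S : is_subfield S ->
  exponent_one_tower r F A x -> (forall y, A y -> S y) ->
  (forall i, (i < r)%N -> S (x i)) -> forall y, F y -> S y.
Proof.
move=> sfS [G [<- Gr step]] AS xS.
have GS j : (j <= r)%N -> forall y, G (r - j)%N y -> S y.
  elim: j => [|j IHj] ltjr y; first by rewrite subn0 Gr; apply: AS.
  have lt1 : (r - j.+1 < r)%N by lia.
  have [_ _ _ /(_ y) gen _] := step _ lt1.
  move=> /gen; apply: adj_min => //; last exact: xS.
  by rewrite -subSn // subSS; apply: IHj; apply: ltnW.
by have := GS r (leqnn r); rewrite subnn.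
Qed.

Lemma derivation_linear m F A D : (forall y, frob_pow p m y -> A y) ->
  (forall y, A y -> F y) -> derives F D -> (forall y, A y -> D y = 0) ->
  forall a y, frob_pow p m a -> F y -> D (a * y) = a * D y.
Proof.
move=> kA AF derD DA a y /kA Aa Fy.
by rewrite (derZ derD) //; [apply: AF | apply: DA].
Qed.

(* In a dual basis (D_i, x_i) of a p-Lie algebra, [D_i, D_j] and D_i^p kill all
   the x_l, hence vanish; the tower is given by the successive kernels. *)
Lemma p_lie_dual_basis m F L : is_subfield F -> p_lie p F L ->
  (forall y, frob_pow p m y -> Ann F L y) ->
  exists r b x, [/\ dual_system F L r b x,
    forall E, L E -> forall y, E y = \sum_(i < r) E (x i) * b i y &
    exponent_one_tower r F (Ann F L) x].
Proof.
move=> sfF [[Lder L0 LD LZ] Lbr Lp] kA.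
have derL D (LD' : L D) : derives F D := derivation_derives (Lder D LD').
have L_at0 D : L D -> D 0 = 0 by move=> /derL /(der0 sfF).
have L_at1 D : L D -> D 1 = 0 by move=> /derL /(der1 sfF).
have Lin E y : L E -> F y -> F (E y) by move=> /Lder[_ + _ _]; apply.
have Lout E y : L E -> ~ F y -> E y = 0 by move=> /Lder[+ _ _ _]; apply.
have [n0 boundN] : exists n0, forall r b x, dual_system F L r b x -> (r <= n0)%N.
  apply: (@dual_system_bounded _ _ hp finK m) => //.
  - by move=> x /kA[].
  - by move=> E x y /derL[+ _]; apply.
  move=> E a x LE; apply: (derivation_linear kA) => //; last 1 first.
  - by move=> y [_]; apply.
  - by move=> y [].
  exact: derL.
have [r [b [x [sys basis]]]] := dual_basis sfF LD LZ Lin Lout boundN.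
have [Lb Fx bx] := sys; exists r, b, x; split=> //.
have b01 i j : (i < r)%N -> (j < r)%N -> (b i (x j) = 0) \/ (b i (x j) = 1).
  by move=> lti ltj; rewrite bx //; case: (i == j); [right | left].
have bb0 i j l : (i < r)%N -> (j < r)%N -> (l < r)%N -> b i (b j (x l)) = 0.
  move=> lti ltj ltl; have Lbi := Lb _ lti.
  by case: (b01 j l) => // ->; [apply: L_at0 | apply: L_at1].
have bC i j y : (i < r)%N -> (j < r)%N -> b i (b j y) = b j (b i y).
  move=> lti ltj; apply/eqP; rewrite -subr_eq0; apply/eqP.
  have := basis _ (Lbr _ _ (Lb _ lti) (Lb _ ltj)) y; rewrite /lie_br => ->.
  by rewrite big1 // => l _; rewrite !bb0 // subrr mul0r.
have bp i y : (i < r)%N -> iter p (b i) y = 0.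
  move=> lti; have := basis _ (Lp _ (Lb _ lti)) y; rewrite /pth_pow => ->.
  rewrite big1 // => l _; have := prime_gt1 (pcharf_prime hp).
  case: (p) => [|[|q]] // _; rewrite !iterSr bb0 //.
  by elim: q => [|q IHq]; rewrite ?mul0r // iterSr L_at0 //; apply: Lb.
pose G j := Ann F (fun D => exists2 i, (i < j)%N & D = b i).
exists G; split.
- by apply/predeqP => y; split=> [[]|Fy] //; split=> // D [].
- apply/predeqP => y; split=> [[Fy Gy]|[Fy Ly]]; split=> // D.
    move=> LD'; rewrite basis // big1 // => i _.
    by rewrite Gy ?mulr0 //; exists i.
  by case=> i ltir ->; apply/Ly/Lb.
move=> j ltjr.
have sfG i : (i <= r)%N -> is_subfield (G i).
  move=> leir; apply: Ann_subfield => // D [l ltli ->].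
  by apply/derL/Lb/(leq_trans ltli).
have GE y : G j.+1 y <-> G j y /\ b j y = 0.
  split=> [[Fy Gy]|[[Fy Gy] bjy]].
    split; last by apply: Gy; exists j.
    by split=> // D [i ltij ->]; apply: Gy; exists i => //; apply: leqW.
  split=> // D [i]; rewrite ltnS leq_eqVlt => /predU1P[->|ltij] -> //.
  by apply: Gy; exists i.
have Gx : G j (x j).
  split=> [|D [i ltij ->]]; first exact: Fx.
  by rewrite bx ?ltn_eqF // (ltn_trans ltij).
have sfGj := sfG _ (ltnW ltjr).
have derG : derives (G j) (b j).
  have [bD bM] := derL _ (Lb _ ltjr).
  by split=> y z [Fy _] [Fz _]; [apply: bD | apply: bM].
have bjx : b j (x j) = 1 by rewrite bx // eqxx.
(* Commutation of the b_i is what makes b_j preserve the common kernel G_j of b_0, ..., b_(j-1), as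
   [taylor] requires. *)
have Gb y : G j y -> G j (b j y).
  case=> Fy Gy; split=> [|D [i ltij ->]]; first by apply: Lin => //; apply: Lb.
  have ltir := ltn_trans ltij ltjr.
  by rewrite bC // Gy; [apply/L_at0/Lb | exists i].
split=> //.
- exact: sfG.
- by move=> y /GE[].
- move=> y Gy.
  have [c kc ->] := taylor hp sfGj derG Gx bjx Gb (fun z _ => bp j z ltjr) Gy.
  by exists c => // i; apply/GE.
move=> c Gc; apply: (powers_independent hp sfGj derG Gx bjx (leqnn p)).
by move=> i; apply/GE.
Qed.

(** The kernel of [D] is a subfield containing [A] and the generators [x i]. *)
Lemma derives_eq0 F A r x D : is_subfield F -> exponent_one_tower r F A x ->
  (forall y, A y -> F y) -> (forall i, (i < r)%N -> F (x i)) -> derives F D ->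
  (forall y, A y -> D y = 0) -> (forall i, (i < r)%N -> D (x i) = 0) ->
  forall y, F y -> D y = 0.
Proof.
move=> sfF tow AF Fx derD DA Dx y Fy.
have sfk := der_kernel_subfield sfF derD.
suff [] : F y /\ D y = 0 by [].
apply: (exponent_one_tower_min sfk tow _ _ Fy) => [z Az|i ltir].
  by split; [apply: AF | apply: DA].
by split; [apply: Fx | apply: Dx].
Qed.

(** A derivation [E] over Ann L minus the sum of the E(x_i) b_i kills Ann L and all x_i, hence is
    zero on [F]; so [E] lies in [L]. *)
Lemma p_lie_rel_derE m F L : is_subfield F -> p_lie p F L ->
  (forall y, frob_pow p m y -> Ann F L y) -> rel_der F (Ann F L) = L.
Proof.
move=> sfF lieL kA; have [r [b [x [[Lb Fx bx] basis tow]]]] :=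
  p_lie_dual_basis sfF lieL kA.
have [[Lder L0 LD LZ] _ _] := lieL.
apply/predeqP => E; split=> [[dE EA]|LE]; last first.
  by split=> [|y [_]]; [apply: Lder | apply].
have -> : E = fun y => @zero_fun K y + \sum_(i < r) E (x i) * b i y.
  apply: funext => y; rewrite /zero_fun add0r.
  have [Fy|nFy] := EM (F y); last first.
    have [Eout _ _ _] := dE; rewrite Eout // big1 // => i _.
    by have [bout _ _ _] := Lder _ (Lb _ (ltn_ord i)); rewrite bout // mulr0.
  apply/eqP; rewrite -subr_eq0; apply/eqP.
  apply: (derives_eq0 (D := fun y => E y - \sum_(i < r) E (x i) * b i y)
    sfF tow _ Fx) => //.
  - by move=> z [].
  - have [_ _ ED EM'] := dE; split=> u v Fu Fv.
      rewrite /= ED // addrACA -opprD -big_split; congr (_ - _).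
      apply: eq_bigr => i _ /=; have [_ _ bD _] := Lder _ (Lb _ (ltn_ord i)).
      by rewrite bD // mulrDr.
    rewrite /= EM' // !mulrBr addrACA -opprD !mulr_sumr -big_split.
    congr (_ - _); apply: eq_bigr => i _ /=.
    have [_ _ _ bM] := Lder _ (Lb _ (ltn_ord i)).
    by rewrite bM //; ring.
  - move=> z Az; rewrite EA // big1 ?subrr // => i _.
    by case: Az => _ /(_ _ (Lb _ (ltn_ord i))) ->; rewrite mulr0.
  move=> i ltir; rewrite (bigD1 (Ordinal ltir)) //= bx // eqxx mulr1 big1.
    by rewrite addr0 subrr.
  by move=> l ne_li; rewrite bx // (negPf ne_li : (l == i :> nat) = false) mulr0.
apply: (@span_closed _ F L LD LZ r b (fun i => E (x i))) => // i ltir.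
by have [_ Ein _ _] := dE; apply/Ein/Fx.
Qed.

Lemma field_dim_fin A F (I : finType) (b : I -> K) :
  (forall i, F (b i)) ->
  (forall c : I -> K, (forall i, A (c i)) -> \sum_i c i * b i = 0 ->
     forall i, c i = 0) ->
  (forall v, F v -> exists c : I -> K, (forall i, A (c i)) /\ v = \sum_i c i * b i) ->
  field_dim A F #|I|.
Proof.
move=> Fb indep span; exists (fun i => b (enum_val i)); split=> // [c Ac c0 i|v].
  rewrite -[i]enum_valK; apply: (indep (fun j => c (enum_rank j))) => //.
  rewrite -[RHS]c0 (reindex_onto _ _ (fun j _ => enum_rankK j)) /=.
  by apply: eq_big => j; rewrite enum_valK ?eqxx.
move=> /span[c [Ac ->]]; exists (fun i => c (enum_val i)); split=> //.
rewrite (reindex_onto _ _ (fun j _ => enum_rankK j)).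
by apply: eq_bigl => j; rewrite enum_valK eqxx.
Qed.

(** Multiplicativity of degrees: each step multiplies a basis by the powers of x_j below p. *)
Lemma exponent_one_tower_dim r F A x : is_subfield F ->
  exponent_one_tower r F A x -> field_dim A F (p ^ r).
Proof.
move=> sfF [G [G0 <- step]].
suff dimG j : (j <= r)%N -> [/\ is_subfield (G j), forall y, G j y -> F y &
    field_dim (G j) F (p ^ j)] by have [] := dimG r (leqnn r).
elim: j => [|j IHj] ltjr.
  rewrite G0; split=> //; exists (fun=> 1); split=> [_|c _|v Fv].
  - exact: subfield1.
  - by rewrite big_ord1 mulr1 => c0 i; rewrite ord1.
  by exists (fun=> v); rewrite big_ord1 mulr1.
have [sfG GF [b [Fb indep span]]] := IHj (ltnW ltjr).
have [sfG' G'G Gx gen indep'] := step j ltjr.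
split=> //; first by move=> y /G'G /GF.
have -> : (p ^ j.+1)%N = #|{: 'I_(p ^ j) * 'I_p}|.
  by rewrite card_prod !card_ord expnSr.
have sumE (c : 'I_(p ^ j) * 'I_p -> K) :
    \sum_ij c ij * (b ij.1 * x j ^+ ij.2) =
    \sum_i (\sum_(l < p) c (i, l) * x j ^+ l) * b i.
  transitivity (\sum_i \sum_(l < p) c (i, l) * (b i * x j ^+ l)).
    by rewrite pair_bigA; apply: eq_bigr => -[i l].
  by apply: eq_bigr => i _; rewrite mulr_suml; apply: eq_bigr => l _; ring.
apply: (field_dim_fin (b := fun ij : 'I_(p ^ j) * 'I_p => b ij.1 * x j ^+ ij.2)).
- by move=> [i l]; apply: subfieldM => //=; apply: subfieldX => //; apply: GF.
- move=> c Gc; rewrite sumE => c0 [i l].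
  have ci : \sum_(l < p) c (i, l) * x j ^+ l = 0.
    apply: (indep (fun i => \sum_(l < p) c (i, l) * x j ^+ l)) => // i'.
    apply: subfield_sum => // l' _; apply: subfieldM => //; first exact: G'G.
    exact: subfieldX.
  pose d n := if insub n is Some l' then c (i, l') else 0.
  have dE (l' : 'I_p) : d l' = c (i, l') by rewrite /d valK.
  rewrite -dE; apply: indep' => // [n|].
    by rewrite /d; case: insub => // *; apply: subfield0.
  by rewrite -[RHS]ci; apply: eq_bigr => l' _; rewrite dE.
move=> v /span[c [Gc ->]].
have /choice[d dP] : forall i, exists d : nat -> K,
    (forall l, G j.+1 (d l)) /\ c i = \sum_(l < p) d l * x j ^+ l.
  by move=> i; have [d] := gen _ (Gc i); exists d.
exists (fun ij : 'I_(p ^ j) * 'I_p => d ij.1 ij.2); split.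
  by move=> [i l]; apply: (dP i).1.
rewrite (sumE (fun ij : 'I_(p ^ j) * 'I_p => d ij.1 ij.2)); apply: eq_bigr => i _.
by rewrite (dP i).2.
Qed.

(* The last nonzero iterate of ad y on a linear form detecting y is a
   multiplication; the iterate before it is a derivation up to a constant. *)
Lemma simple_derivation m N y : is_subfield N ->
  (forall x, frob_pow p m x -> N x) -> ~ N y -> N (y ^+ p) ->
  exists D, [/\ derives (adj N p y) D,
    forall x, adj N p y x -> adj N p y (D x), forall x, N x -> D x = 0 & D y = 1].
Proof.
move=> sfN kN nNy Nyp; have p0 := pchar_gt0 hp.
have sfM : is_subfield (adj N p y).
  by apply: (adj_subfield sfN p0 Nyp (pexp_gt0 hp m)) => x; apply: kN; exists x.
set M := adj N p y in sfM *.
have NM x : N x -> M x by apply: adj_const.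
have My : M y by apply: adj_gen.
have M1 := subfield1 sfM.
have [phi [lin_phi N_phi phi1 phiy]] := linear_detect finK sfN kN nNy.
pose u j := iter j (ad y) phi.
have lin_u j : linear_over N (u j).
  by elim: j => // j; apply: linear_over_ad.
have Mu j f : M f -> M (u j f).
  elim: j f => [|j IHj] f Mf; first exact/NM/N_phi.
  apply: subfieldB => //; first by apply: subfieldM => //; apply: IHj.
  by apply: IHj; apply: subfieldM.
(* [P p] holds because (ad y)^p = ad (y^p) and y^p is in [N]; [P 1] fails at f = 1. So some u_(k+1)
   is nonzero on [M] while u_(k+2) vanishes there. *)
pose P j := forall f, M f -> u j f = 0.
have P_p : P p.
  move=> f Mf; rewrite /u; have := iter_ad_pexp hp 1 y phi.
  by rewrite expn1 => ->; rewrite /ad (proj2 lin_phi) // subrr.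
have nP1 : ~ P 1%N.
  move=> /(_ 1 M1); rewrite /u /= /ad phi1 mulr1 phiy mulr0 sub0r => /eqP.
  by rewrite oppr_eq0 oner_eq0.
have [k nPk Pk] : exists2 k, ~ P k.+1 & P k.+2.
  apply: contrapT => no_k.
  have nP n : ~ P n.+1 by elim: n => // n IHn Pn; apply: no_k; exists n.
  by have := nP p.-1; rewrite prednK.
(* Commuting with [y] and with [N], the map u_(k+1) is multiplication on [M] by its value [c] at
   1. *)
have ucomm f : M f -> u k.+1 (y * f) = y * u k.+1 f.
  by move=> Mf; apply/esym/eqP; rewrite -subr_eq0; apply/eqP/Pk.
pose c := u k.+1 1.
have uc f : M f -> u k.+1 f = f * c.
  move=> Mf; suff [] : M f /\ u k.+1 f = f * c by [].
  apply: (adj_ind (P := fun f => M f /\ u k.+1 f = f * c) sfN _ _ _ _ Mf) =>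
    [|f1 f2 [M1' E1] [M2' E2]|n f1 Nn [M1' E1]|f1 [M1' E1]].
  - by rewrite mul1r.
  - by split; [apply: adjD | rewrite (proj1 (lin_u _)) E1 E2 mulrDl].
  - by split; [apply: adjZ | rewrite (proj2 (lin_u _)) // E1 mulrA].
  - by split; [apply: adj_shift | rewrite ucomm // E1 mulrA].
have c0 : c != 0.
  by apply/eqP => c0; apply: nPk => f Mf; rewrite uc // c0 mulr0.
have Mc : M c by apply: Mu.
(* Since [y, u_k] = c on [M], scaling by - c^-1 gives [D, y] = 1; the subtracted multiplication
   forces D 1 = 0. *)
pose D f := - c^-1 * (u k f - f * u k 1).
have DD f g : D (f + g) = D f + D g by rewrite /D (proj1 (lin_u k)); ring.
have DZ n f : N n -> D (n * f) = n * D f.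
  by move=> Nn; rewrite /D (proj2 (lin_u k)) //; ring.
have D1 : D 1 = 0 by rewrite /D mul1r subrr mulr0.
have Dy f : M f -> D (y * f) = y * D f + f.
  move=> Mf; have ukE : u k (y * f) = y * u k f - f * c.
    by rewrite -uc // /u iterS -/(u k) /ad; ring.
  by rewrite /D ukE; field.
have DM f g : M f -> M g -> D (f * g) = f * D g + g * D f.
  move=> Mf Mg; suff [] : M f /\ D (f * g) = f * D g + g * D f by [].
  apply: (adj_ind (P := fun f => M f /\ D (f * g) = f * D g + g * D f) sfN
    _ _ _ _ Mf) => [|f1 f2 [M1' E1] [M2' E2]|n f1 Nn [M1' E1]|f1 [M1' E1]].
  - by rewrite !mul1r D1 mulr0 addr0.
  - by split; [apply: adjD | rewrite mulrDl !DD E1 E2; ring].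
  - by split; [apply: adjZ | rewrite -mulrA !(DZ n) // E1; ring].
  - split; first exact: adj_shift.
    by rewrite -mulrA !Dy //; [rewrite E1; ring | apply: subfieldM].
exists D; split=> //.
- move=> f Mf; apply: subfieldM => //; first exact: subfieldN (subfieldV _ _).
  by apply: subfieldB => //; [apply: Mu | apply: subfieldM => //; apply: Mu].
- by move=> a Na; rewrite -[a]mulr1 DZ // D1 mulr0.
- by rewrite -[y]mulr1 Dy // D1 mulr0 add0r.
Qed.

Lemma derivation_exists m F A x : is_subfield F -> is_subfield A ->
  (forall y, A y -> F y) -> (forall y, frob_pow p m y -> A y) ->
  (forall y, F y -> A (y ^+ p)) -> F x -> ~ A x ->
  exists2 D, rel_der F A D & D x != 0.
Proof.
move=> sfF sfA AF kA FpA Fx nAx; have p0 := pchar_gt0 hp.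
have adj_sf M y : is_subfield M -> (forall z, A z -> M z) -> M (y ^+ p) ->
    is_subfield (adj M p y).
  move=> sfM AM Myp; apply: (adj_subfield sfM p0 Myp (pexp_gt0 hp m)) => z.
  by apply/AM/kA; exists z.
(* Adjoin generators of F to A one at a time, skipping those that would bring x
   in. A skipped generator y lies in M(x): otherwise d/dy on M(x)(y)/M(x) kills
   x, and x in M(y) forces x in M. *)
have [M [sfM AM MF nMx genF]] : exists M, [/\ is_subfield M,
    forall y, A y -> M y, forall y, M y -> F y, ~ M x &
    forall y, F y -> adj M p x y].
  have [I [b span_b]] := finK m.
  have F0 : subspace F (fun y => y = 0).
    by split=> // [y z -> ->|a y _ ->]; rewrite ?addr0 ?mulr0.
  (* An F-linear projection of [K] onto [F] sends a finite spanning family of [K] to one of [F], so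
     the maximal [M] is reached by finite induction. *)
  have [pr [lin_pr F_pr _ pr1]] := linear_functional finK sfF
    (fun y ky => AF _ (kA y ky)) F0 (elimN eqP (oner_neq0 K)).
  suff [M [sfM AM MF nMx genM]] : exists M, [/\ is_subfield M,
      forall y, A y -> M y, forall y, M y -> F y, ~ M x &
      forall y, y \in [seq pr (b i) | i : I] -> adj M p x y].
    exists M; split=> // y Fy; have sfMx := adj_sf M x sfM AM (AM _ (FpA _ Fx)).
    have -> : y = pr y by rewrite -[in RHS](mulr1 y) (proj2 lin_pr) // pr1 mulr1.
    have [c ->] := span_b y; rewrite (linear_over_sum _ _ _ lin_pr).
    apply: subfield_sum => // i _.
    have kc : frob_pow p m (c i ^+ (p ^ m)) by exists (c i).
    rewrite (proj2 lin_pr); last exact/AF/kA.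
    apply: subfieldM => //; last exact/genM/codom_f.
    exact/adj_const/AM/kA.
  have: forall y, y \in [seq pr (b i) | i : I] -> F y.
    by move=> _ /codomP[i ->].
  elim: (image _ _) => [|y s IHs] Fs; first by exists A.
  have [|M [sfM AM MF nMx genM]] := IHs.
    by move=> z zs; apply: Fs; rewrite inE zs orbT.
  have Fy : F y by apply/Fs/mem_head.
  have Mxp : M (x ^+ p) by apply/AM/FpA.
  have Myp : M (y ^+ p) by apply/AM/FpA.
  have [Mxy|nMxy] := EM (adj M p x y).
    by exists M; split=> // z; rewrite inE => /predU1P[->|/genM].
  have sfMx := adj_sf M x sfM AM Mxp.
  have MMx z : M z -> adj M p x z by apply: adj_const.
  have MMy z : M z -> adj M p y z by apply: adj_const.
  have sfMy := adj_sf M y sfM AM Myp.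
  exists (adj M p y); split=> //.
  - by move=> z /AM /MMy.
  - by move=> z; apply: adj_min.
  - move=> Myx; have [D [derD _ D0 Dy]] := simple_derivation sfMx
      (fun z kz => MMx z (AM z (kA z kz))) nMxy (MMx _ Myp).
    have sfMxy : is_subfield (adj (adj M p x) p y).
      apply: (adj_subfield sfMx p0 (MMx _ Myp) (pexp_gt0 hp m)) => z.
      by apply/MMx/AM/kA; exists z.
    apply: nMx; apply: (der_adj_const hp sfMxy derD _ Dy _ Myx).
    + by apply: adj_gen => //; apply: MMx.
    + move=> z Mz; split; last by apply/D0/MMx.
      by apply: adj_const => //; apply: MMx.
    + by apply: D0; apply: adj_gen.
  move=> z; rewrite inE => /predU1P[->|/genM].
    by apply: adj_const => //; apply: adj_gen.
  by case=> c Mc ->; exists c => // i; apply: MMy.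
have Mxp : M (x ^+ p) by apply/AM/FpA.
have [D [[DD DM] MD D0 Dx]] :=
  simple_derivation sfM (fun z kz => AM z (kA z kz)) nMx Mxp.
exists (fun y => if `[< F y >] then D y else 0); last first.
  by rewrite asboolT // Dx oner_eq0.
split; last by move=> y Ay; rewrite asboolT; [apply/D0/AM | apply: AF].
split=> [y nFy|y Fy|y z Fy Fz|y z Fy Fz].
- by rewrite asboolF.
- rewrite asboolT //; have := MD _ (genF _ Fy); apply: adj_min => //.
- by rewrite !asboolT //; [apply: DD; apply: genF | apply: subfieldD].
- by rewrite !asboolT //; [apply: DM; apply: genF | apply: subfieldM].
Qed.

End ExponentOne.


(** * The three bijections and the ranks *)

Section Correspondence.
Local Open Scope ring_scope.
Variables (K : fieldType) (p : nat).
Hypothesis hp : p \in [pchar K].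
Hypothesis finK : frob_finite K p.
Implicit Types (F A N M S : K -> Prop) (L Dd : (K -> K) -> Prop) (D E : K -> K).
Implicit Types (W : nat -> K -> Prop) (J : nat -> (K -> K) -> Prop).

(** Lets membership of all p-th powers in [S] be checked on field generators. *)
Lemma frob_preimage_subfield S : is_subfield S -> is_subfield (fun x => S (x ^+ p)).
Proof.
move=> sfS; have p0 := pchar_gt0 hp.
split; first by rewrite expr0n gtn_eqF //; apply: subfield0.
split; first by rewrite expr1n; apply: subfield1.
split.
  by move=> x y Sx Sy; have := pexpD hp 1 x y; rewrite expn1 => ->; apply: subfieldD.
split.
  by move=> x Sx; have := pexpN hp 1 x; rewrite expn1 => ->; apply: subfieldN.
split; first by move=> x y Sx Sy; rewrite exprMn; apply: subfieldM.
by move=> x Sx; rewrite exprVn; apply: subfieldV.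
Qed.

Lemma frob_powSE m (x : K) : frob_pow p m.+1 x -> exists2 y, frob_pow p m y & x = y ^+ p.
Proof.
by case=> y ->; exists (y ^+ (p ^ m)); [exists y | rewrite -exprM -expnSr].
Qed.

Lemma Ann_rel_der m F A : is_subfield F -> is_subfield A ->
  (forall y, A y -> F y) -> (forall y, frob_pow p m y -> A y) ->
  (forall y, F y -> A (y ^+ p)) -> Ann F (rel_der F A) = A.
Proof.
move=> sfF sfA AF kA FpA; apply/predeqP => x; split=> [[Fx Ax]|Ax].
  apply: contrapT => nAx.
  have [D dD] := derivation_exists hp finK sfF sfA AF kA FpA Fx nAx.
  by rewrite Ax // eqxx.
by split=> [|D [_ ->]] //; apply: AF.
Qed.

(** * From power towers to Jacobson sequences, and the ranks *)

Section PowerTower.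
Variable W : nat -> K -> Prop.
Hypothesis towW : power_tower p W.

Lemma tower_subfield i : is_subfield (W i).
Proof. by case: towW. Qed.

Lemma tower_le i j x : (j <= i)%N -> W i x -> W j x.
Proof. by move=> /(proj2 towW) ->; apply: compositum_l. Qed.

Lemma tower_frob i x : frob_pow p i x -> W i x.
Proof. by rewrite (proj2 towW i i) //; apply: compositum_r. Qed.

Lemma tower0 : W 0%N = @fullK K.
Proof.
by apply/predeqP => x; split=> // _; apply: tower_frob; rewrite frob_pow0.
Qed.

(** W_i is generated by W_(i+1) and K^(p^i), whose p-th powers lie in W_(i+1). Each step of a tower
    thus has exponent one. *)
Lemma tower_pth i x : W i x -> W i.+1 (x ^+ p).
Proof.
have sfS := frob_preimage_subfield (tower_subfield i.+1).
rewrite (proj2 towW i.+1 i) //; apply: (compositum_sub sfS) => y.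
  by move=> Wy; apply: subfieldX => //; apply: tower_subfield.
by move=> /frob_powS; apply: tower_frob.
Qed.

Lemma tower_Ann i : Ann (W i) (rel_der (W i) (W i.+1)) = W i.+1.
Proof.
apply: (@Ann_rel_der i.+1); try exact: tower_subfield.
- by move=> y; apply: tower_le.
- exact: tower_frob.
- exact: tower_pth.
Qed.

Lemma tower_jbase : jac_to_tower (tower_to_jac W) = W.
Proof.
apply: funext; elim=> [|i IHi]; first by rewrite tower0.
by rewrite /jac_to_tower /= -/(jac_to_tower _ i) IHi tower_Ann.
Qed.

(** The transversality condition holds since a derivation killing W_(i+2) and K^(p^(i+1)) kills
    their compositum W_(i+1). *)
Lemma tower_to_jac_jacobson : jacobson_seq p (tower_to_jac W).
Proof.
have jE i : jbase (tower_to_jac W) i = W i by rewrite -[in RHS]tower_jbase.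
split; first by rewrite -tower0; apply: p_lie_rel_der => //; apply: tower_subfield.
move=> i; rewrite jE; split; first exact/p_lie_rel_der/tower_subfield.
move=> D [dD D0] [_ Dk]; have [Dout _ _ _] := dD; apply: funext => x.
have [Wx|/Dout //] := EM (W i.+1 x).
have sfW := tower_subfield i.+1.
have sfk := der_kernel_subfield sfW (derivation_derives dD).
suff [] : W i.+1 x /\ D x = 0 by [].
move: Wx; rewrite {1}(proj2 towW i.+2 i.+1) //.
apply: (compositum_sub sfk) => y Wy; split.
- exact: tower_le Wy.
- exact: D0.
- exact: tower_frob.
- exact: Dk.
Qed.

(** Bundles the data giving both the dimension of the derivations and the field degree, so that the
    same [r] serves for both. *)
Definition rank_basis i r : Prop :=
  exists (b : nat -> K -> K) (x : nat -> K),
    [/\ dual_system (W i) (rel_der (W i) (W i.+1)) r b x,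
        forall E, rel_der (W i) (W i.+1) E ->
          forall y, E y = \sum_(j < r) E (x j) * b j y &
        exponent_one_tower p r (W i) (W i.+1) x].

Lemma rank_basis_exists i : exists r, rank_basis i r.
Proof.
have kA y : frob_pow p i.+1 y -> Ann (W i) (rel_der (W i) (W i.+1)) y.
  by rewrite tower_Ann; apply: tower_frob.
have [r [b [x]]] := p_lie_dual_basis hp finK (tower_subfield i)
  (p_lie_rel_der hp _ (tower_subfield i)) kA.
by rewrite tower_Ann => basis; exists r, b, x.
Qed.

Lemma rank_basis_der_dim i r : rank_basis i r -> der_dim (W i) (tower_to_jac W i) r.
Proof.
case=> b [x [[Lb Wx bx] basis _]].
exists (fun j : 'I_r => b j); split=> [j|c Wc c0 j|E LE]; first exact: Lb.
  have /(congr1 (fun f => f (x j))) := c0.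
  rewrite /zero_fun (bigD1 j) //= bx // eqxx mulr1 big1 ?addr0 // => l ne_lj.
  by rewrite bx // (negPf ne_lj : (l == j :> nat) = false) mulr0.
exists (fun j => E (x j)); split; last by apply: funext => y; apply: basis.
by move=> j; case: LE => -[_ + _ _] _; apply; apply: Wx.
Qed.

Lemma rank_basis_field_dim i r : rank_basis i r ->
  field_dim (W i.+1) (W i) (p ^ r).
Proof.
by case=> b [x [_ _ tow]]; apply: exponent_one_tower_dim tow; apply: tower_subfield.
Qed.

(* If x_1, ..., x_r generate W_i over W_(i+1), their p-th powers generate W_(i+1)
   over W_(i+2). *)
Lemma rank_basis_le i r r' : rank_basis i r -> rank_basis i.+1 r' -> (r' <= r)%N.
Proof.
case=> b [x [[_ Wx _] _ tow]] [b' [x' [[Lb' Wx' bx'] _ _]]].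
(* A left kernel vector of [C] defines a combination [D] of the b'_l killing every x_j^p, hence all
   of W_(i+1). Its value at x'_a is the a-th entry of the vector, so [C] has independent rows. *)
pose C : 'M[K]_(r', r) := \matrix_(a, j) b' a (x j ^+ p).
suff: row_free C by move=> /eqP <-; apply: rank_leq_col.
rewrite -kermx_eq0; apply/negPn/negP => /matrix0Pn[k [a /eqP]]; apply.
pose D y := \sum_(l < r') kermx C k l * b' l y.
have sfW := tower_subfield i.+1.
have derD : derives (W i.+1) D.
  split=> u v Wu Wv; rewrite /D.
    rewrite -big_split; apply: eq_bigr => l _ /=.
    by have [[_ _ bD _] _] := Lb' _ (ltn_ord l); rewrite bD // mulrDr.
  rewrite !mulr_sumr -big_split; apply: eq_bigr => l _ /=.
  by have [[_ _ _ bM] _] := Lb' _ (ltn_ord l); rewrite bM //; ring.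
have sfk := der_kernel_subfield sfW derD.
have D0 y : W i.+2 y -> W i.+1 y /\ D y = 0.
  move=> Wy; split; first exact: tower_le Wy.
  rewrite /D big1 // => l _.
  by have [_ ->] := Lb' _ (ltn_ord l); rewrite ?mulr0.
have [_ Dx'] : W i.+1 (x' a) /\ D (x' a) = 0.
  have := Wx' _ (ltn_ord a); rewrite {1}(proj2 towW i.+2 i.+1) //.
  apply: (compositum_sub sfk) => // _ /frob_powSE[z /tower_frob Wz ->].
  apply: (exponent_one_tower_min hp (frob_preimage_subfield sfk) tow _ _ Wz) => [y Wy|].
    exact/D0/tower_pth.
  move=> j ltjr; split; first by apply/tower_pth/Wx.
  have := congr1 (fun B : 'M__ => B k (Ordinal ltjr)) (mulmx_ker C).
  by rewrite !mxE => <-; apply: eq_bigr => l _; rewrite [C l _]mxE.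
rewrite -Dx' /D (bigD1 a) //= bx' // eqxx mulr1 big1 ?addr0 // => l ne_la.
by rewrite bx' // (negPf ne_la : (l == a :> nat) = false) mulr0.
Qed.

End PowerTower.

(** * From Jacobson sequences to power towers *)

Section Jacobson.
Variable J : nat -> (K -> K) -> Prop.
Hypothesis jacJ : jacobson_seq p J.

Lemma jacobson_p_lie i : p_lie p (jbase J i) (J i).
Proof. by case: jacJ => J0 JS; case: i => // i; case: (JS i). Qed.

Lemma jbase_subfield i : is_subfield (jbase J i).
Proof.
elim: i => [|i IHi]; first exact: fullK_subfield.
have [[Lder _ _ _] _ _] := jacobson_p_lie i.
by apply: Ann_subfield => // D /Lder /derivation_derives.
Qed.

Lemma jacobson_derives i D : J i D -> derives (jbase J i) D.
Proof.
by have [[Lder _ _ _] _ _] := jacobson_p_lie i => /Lder /derivation_derives.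
Qed.

Lemma jbase_pth i x : jbase J i x -> jbase J i.+1 (x ^+ p).
Proof.
move=> Jx; split=> [|D /jacobson_derives derD].
  by apply: subfieldX => //; apply: jbase_subfield.
exact: (der_pth hp (jbase_subfield i) derD Jx).
Qed.

Lemma jbase_frob i x : frob_pow p i x -> jbase J i x.
Proof.
elim: i x => [|i IHi] x //.
by move=> /frob_powSE[y /IHi Jy ->]; apply: jbase_pth.
Qed.

Lemma jbase_rel_der i : rel_der (jbase J i) (jbase J i.+1) = J i.
Proof.
apply: (@p_lie_rel_derE _ _ hp finK i.+1).
- exact: jbase_subfield.
- exact: jacobson_p_lie.
- exact: jbase_frob.
Qed.

(** Outside the compositum [x] would be moved by a derivation over it. This derivation belongs to
    [J i] and kills K^(p^i), against transversality. *)
Lemma jbase_step i x : jbase J i x ->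
  compositum (jbase J i.+1) (frob_pow p i) x.
Proof.
set M := compositum _ _ => Jx; apply: contrapT => nMx.
have sfM : is_subfield M by apply: compositum_subfield.
have JM y : jbase J i.+1 y -> M y by apply: compositum_l.
have MJ y : M y -> jbase J i y.
  apply: (compositum_sub (jbase_subfield i)) => z; first by case.
  exact: jbase_frob.
have [D [dD DM] Dx] := derivation_exists hp finK (jbase_subfield i) sfM MJ
  (fun y ky => JM y (jbase_frob ky)) (fun y Jy => JM _ (jbase_pth Jy)) Jx nMx.
have JD : J i D.
  by rewrite -jbase_rel_der; split=> // y /JM; apply: DM.
have Dk y : frob_pow p i y -> D y = 0 by move=> ky; apply: DM; apply: compositum_r.
(* Transversality is imposed only from index 1 on; at index 0 the compositum contains K^(p^0) =
   K. *)
have [i0|i_gt0] := posnP i.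
  by apply: nMx; apply: compositum_r; rewrite i0 frob_pow0.
have [_ /(_ i.-1)[_]] := jacJ.
rewrite prednK // => /(_ D JD (conj dD Dk)) D0.
by rewrite D0 /zero_fun eqxx in Dx.
Qed.

(** The one-step generation [jbase_step] is iterated, each K^(p^(n+j)) being absorbed in K^(p^j). *)
Lemma jbase_tower : power_tower p (jac_to_tower J).
Proof.
rewrite /jac_to_tower; split=> [i|i j leji]; first exact: jbase_subfield.
have decr n : forall x, jbase J (n + j) x -> jbase J j x.
  by elim: n => // n IHn x []/IHn.
apply/predeqP => x; split; last first.
  apply: (compositum_sub (jbase_subfield j)) => y; last exact: jbase_frob.
  by rewrite -(subnK leji); apply: decr.
rewrite -(subnK leji); elim: (i - j)%N x => [|n IHn] x Jx; first exact: compositum_l.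
apply: (compositum_sub (compositum_subfield _ _) _ _ (IHn x Jx)) => y.
  move=> /jbase_step; apply: compositum_sub; first exact: compositum_subfield.
    exact: compositum_l.
  by move=> z kz; apply: compositum_r; apply: frob_pow_le kz; apply: leq_addl.
exact: compositum_r.
Qed.

Lemma jbase_tower_to_jac : tower_to_jac (jac_to_tower J) = J.
Proof. by apply: funext => i; apply: jbase_rel_der. Qed.

End Jacobson.

Lemma is_diffop_sub A A' D : (forall x, A' x -> A x) ->
  is_diffop A (@fullK K) D -> is_diffop A' (@fullK K) D.
Proof. by move=> AA' [? ? ? DZ ?]; split=> // a x /AA'; apply: DZ. Qed.

Lemma commutant_subfield L : (forall E, L E -> forall x y, E (x + y) = E x + E y) ->
  is_subfield (commutant L).
Proof.
move=> addL; have L0 E : L E -> E 0 = 0.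
  by move=> /addL ED; apply: (addrI (E 0)); rewrite -ED !addr0.
split; first by move=> E /L0 E0 y; rewrite !mul0r E0.
split; first by move=> E _ y; rewrite !mul1r.
split.
  by move=> a b Ca Cb E LE y; rewrite !mulrDl addL // Ca // Cb.
split.
  move=> a Ca E LE y; rewrite !mulNr; apply: (addrI (a * E y)).
  by rewrite subrr (Ca _ LE) -addL // subrr L0.
split.
  by move=> a b Ca Cb E LE y; rewrite -!mulrA Cb // Ca.
move=> a Ca E LE y; have [->|a0] := eqVneq a 0; first by rewrite invr0 !mul0r L0.
by apply: (mulfI a0); rewrite (Ca E LE) !mulrA mulfV // !mul1r.
Qed.

(** * From power towers to algebras of operators *)

Section TowerAlgebra.
Variable W : nat -> K -> Prop.
Hypothesis towW : power_tower p W.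

Lemma tower_diffop n D : is_diffop (W n) (@fullK K) D <-> linear_over (W n) D.
Proof. exact: (is_diffop_linear hp finK _ (@tower_frob _ towW n)). Qed.

Lemma tower_linear_le i j D : (i <= j)%N -> linear_over (W i) D ->
  linear_over (W j) D.
Proof. by move=> leij; apply: linear_over_sub => x; apply: tower_le. Qed.

Lemma tower_alg_subalg : diff_subalg (@perfect_core K p) (tower_to_alg W).
Proof.
split=> [a|D E [i Di] [j Ej]|D E [i Di] [j Ej]|D [i Di]].
- by exists 0%N; apply/tower_diffop/linear_over_mul.
- exists (maxn i j); apply/tower_diffop/linear_over_add.
    by apply: (tower_linear_le (leq_maxl i j)); apply/tower_diffop.
  by apply: (tower_linear_le (leq_maxr i j)); apply/tower_diffop.
- exists (maxn i j); apply/tower_diffop/linear_over_comp.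
    by apply: (tower_linear_le (leq_maxl i j)); apply/tower_diffop.
  by apply: (tower_linear_le (leq_maxr i j)); apply/tower_diffop.
by apply: is_diffop_sub Di => x /(perfect_core_frob i); apply: tower_frob.
Qed.

(** Elements outside W_m are excluded by [linear_detect]. Conversely, an operator linear over W_n
    and K^(p^m) with n >= m is linear over their compositum W_m; for n <= m it is so because W_m
    lies in W_n. *)
Lemma alg_to_towerK : alg_to_tower p (tower_to_alg W) = W.
Proof.
apply: funext => m; apply/predeqP => x; split=> [Ax|Wx E [n En] Em y].
  apply: contrapT => nWx.
  have [phi [lin_phi _ phi1 phix]] := linear_detect finK (tower_subfield towW m)
    (@tower_frob _ towW m) nWx.
  have phiW : is_diffop (W m) (@fullK K) phi by apply/tower_diffop.
  have := Ax phi (ex_intro _ m phiW)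
    (is_diffop_sub (@tower_frob _ towW m) phiW) 1.
  by rewrite phi1 mulr0 mulr1 phix => /esym /eqP; rewrite oner_eq0.
have [ED EW] := (tower_diffop n E).1 En; have [_ _ _ EK _] := Em.
have [lemn|/ltnW lenm] := leqP m n; last by rewrite EW //; apply: tower_le Wx.
suff /(_ E erefl y) : commutant (fun D => D = E) x by [].
have sfC : is_subfield (commutant (fun D => D = E)).
  by apply: commutant_subfield => _ ->.
move: Wx; rewrite (proj2 towW n m) //; apply: (compositum_sub sfC) => a ha _ -> z.
  by rewrite EW.
by rewrite EK.
Qed.

End TowerAlgebra.

(** * From algebras of operators to power towers and Jacobson sequences *)

Section AlgebraTower.
Variable Dd : (K -> K) -> Prop.
Hypothesis algD : diff_subalg (@perfect_core K p) Dd.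
Let W := alg_to_tower p Dd.

(** Each level is an algebra containing [K] and linear over K^(p^m), so [jacobson_bourbaki] applies
    to it. *)
Let level m D := Dd D /\ linear_over (frob_pow p m) D.

Lemma alg_levelE m D : (Dd D /\ is_diffop (frob_pow p m) (@fullK K) D) <-> level m D.
Proof. by rewrite /level (is_diffop_linear hp finK (m := m)). Qed.

Lemma alg_level m : W m = commutant (level m).
Proof.
apply/predeqP => x; split=> [Wx E /alg_levelE[DE kE]|Cx E DE kE]; first exact: Wx.
by apply: Cx; apply/alg_levelE.
Qed.

Lemma alg_tower_subfield m : is_subfield (W m).
Proof. by rewrite alg_level; apply: commutant_subfield => E [_ []]. Qed.

Lemma alg_tower_frob m x : frob_pow p m x -> W m x.
Proof. by rewrite alg_level => kx E [_ [_ EZ]] y; rewrite EZ. Qed.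

Lemma alg_level_linear m T : linear_over (W m) T -> level m T.
Proof.
have [Dmul DD Dcomp _] := algD.
rewrite alg_level; apply: (jacobson_bourbaki hp finK (m := m)) => //.
- by move=> a; split; [apply: Dmul | apply: linear_over_mul].
- by move=> D E [? ?] [? ?]; split; [apply: DD | apply: linear_over_add].
- by move=> D E [? ?] [? ?]; split; [apply: Dcomp | apply: linear_over_comp].
by move=> E [].
Qed.

Lemma alg_tower_tower : power_tower p W.
Proof.
split=> [i|i j leji]; first exact: alg_tower_subfield.
have le x : W i x -> W j x.
  rewrite !alg_level => Wx E [DE linE]; apply: Wx; split=> //.
  by apply: linear_over_sub linE => y; apply: frob_pow_le.
apply/predeqP => x; split; last first.
  by apply: (compositum_sub (alg_tower_subfield j)); last exact: alg_tower_frob.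
(* A form linear over the compositum but not commuting with [x] is W_i-linear, hence in [Dd], and
   K^(p^j)-linear, hence in level j. This contradicts that [x] is in W_j. *)
move=> Wx; apply: contrapT => nMx.
have [phi [lin_phi _ phi1 phix]] := linear_detect finK (compositum_subfield _ _)
  (fun y => @compositum_r K (W i) _ y) nMx.
have [Dphi _] : level i phi.
  by apply: alg_level_linear; apply: linear_over_sub lin_phi; apply: compositum_l.
have : level j phi.
  by split=> //; apply: linear_over_sub lin_phi; apply: compositum_r.
move: Wx; rewrite alg_level => /(_ phi) /[apply] /(_ 1).
by rewrite phi1 mulr0 mulr1 phix => /esym /eqP; rewrite oner_eq0.
Qed.

Lemma tower_to_algK : tower_to_alg W = Dd.
Proof.
apply/predeqP => T; split=> [[n]|DT].
  by rewrite (tower_diffop alg_tower_tower) => /alg_level_linear[].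
have [_ _ _ Ddiff] := algD.
have [m linT] := diffop_frob_linear hp (Ddiff T DT).
exists m; apply/(tower_diffop alg_tower_tower); split; first by case: linT.
by move=> a x; rewrite alg_level => /(_ T (conj DT linT)) ->.
Qed.

(** An operator in [Dd] is W_n-linear for some n, so a derivation it restricts to kills W_n within
    W_i; it also kills p-th powers, hence W_(i+1) = W_n K^(p^(i+1)) when n > i. Conversely, a
    derivation of W_i over W_(i+1) extends to [K] by composition with a projection. *)
Lemma alg_to_jacE : alg_to_jac p Dd = tower_to_jac W.
Proof.
have towW := alg_tower_tower; have leW := tower_le towW; have kW := tower_frob towW.
apply: funext => i; apply/predeqP => E'; split=> [[dE [E [DE EE']]]|[dE E'0]].
  split=> // x Wx.
  have [n nE] : tower_to_alg W E by rewrite tower_to_algK.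
  have [ED EW] := (tower_diffop towW n E).1 nE.
  have sfW := tower_subfield towW i; have W1 := subfield1 sfW.
  have derE := derivation_derives dE.
  have Wn0 a : W n a -> W i a -> E' a = 0.
    move=> Wa Wia; rewrite -EE' // -[a]mulr1 EW // EE' //.
    by rewrite (der1 sfW derE) mulr0.
  have [lein|/ltnW leni] := leqP i.+1 n; last first.
    by apply: Wn0; [apply: leW Wx | apply: leW Wx].
  have sfk := der_kernel_subfield sfW derE.
  suff [] : W i x /\ E' x = 0 by [].
  move: Wx; rewrite (proj2 towW n i.+1) //.
  apply: (compositum_sub sfk) => [y Wy|_ /frob_powSE[y /kW Wy ->]].
    have Wiy : W i y by apply: leW Wy; apply: ltnW.
    by split=> //; apply: Wn0.
  by split; [apply: (subfieldX sfW) | apply: (der_pth hp sfW derE)].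
split=> //; have sfW := tower_subfield towW i.
have F0 : subspace (W i) (fun y => y = 0).
  by split=> // [y z -> ->|a y _ ->]; rewrite ?addr0 ?mulr0.
(* A W_i-linear projection of [K] onto W_i: composed with [E'] it is W_(i+1)-linear, hence in [Dd],
   and it restricts to [E']. *)
have [pr [[prD prZ] W_pr _ pr1]] := linear_functional finK sfW
  (fun y => kW i y) F0 (elimN eqP (oner_neq0 K)).
have derE := derivation_derives dE.
have le1 a : W i.+1 a -> W i a by apply: leW.
exists (comp_op E' pr); split.
  rewrite -tower_to_algK; exists i.+1; apply/(tower_diffop towW).
  split=> [x y|a x Wa]; rewrite /comp_op.
    by rewrite prD (proj1 derE).
  by rewrite prZ ?(derZ derE) //; [apply: le1 | apply: E'0 | apply: le1].
move=> x Wx; rewrite /comp_op; congr (E' _).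
by rewrite -[x]mulr1 prZ // pr1 mulr1.
Qed.

End AlgebraTower.

End Correspondence.

Theorem mainTheorem1 (K : fieldType) (p : nat) (hp : p \in [pchar K]%R)
  (hfg : fin_gen_over (@perfect_core K p)) :
  (* (a),(b): power towers <-> Jacobson sequences *)
  (forall W : nat -> K -> Prop, power_tower p W ->
     jacobson_seq p (tower_to_jac W) /\ jac_to_tower (tower_to_jac W) = W) /\
  (forall J : nat -> (K -> K) -> Prop, jacobson_seq p J ->
     power_tower p (jac_to_tower J) /\ tower_to_jac (jac_to_tower J) = J) /\
  (* (c): power towers <-> subalgebras K <= D <= Diff_k(K) *)
  (forall W : nat -> K -> Prop, power_tower p W ->
     diff_subalg (@perfect_core K p) (tower_to_alg W) /\
     alg_to_tower p (tower_to_alg W) = W) /\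
  (forall Dd : (K -> K) -> Prop, diff_subalg (@perfect_core K p) Dd ->
     power_tower p (alg_to_tower p Dd) /\
     tower_to_alg (alg_to_tower p Dd) = Dd) /\
  (* (d): unpacking is the composite bijection subalgebras -> Jacobson seqs *)
  (forall Dd : (K -> K) -> Prop, diff_subalg (@perfect_core K p) Dd ->
     jacobson_seq p (alg_to_jac p Dd) /\
     alg_to_jac p Dd = tower_to_jac (alg_to_tower p Dd)) /\
  (* ranks *)
  (forall W : nat -> K -> Prop, power_tower p W ->
     exists r : nat -> nat, forall i,
       [/\ der_dim (W i) (tower_to_jac W i) (r i),
           (r i.+1 <= r i)%N &
           field_dim (W i.+1) (W i) (p ^ r i)]).
Proof.
have finK := fin_gen_frob_finite hp hfg.
split=> [W towW|].
  by split; [apply: tower_to_jac_jacobson | apply: (tower_jbase hp finK)].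
split=> [J jacJ|].
  by split; [apply: (jbase_tower hp finK) | apply: (jbase_tower_to_jac hp finK)].
split=> [W towW|].
  by split; [apply: (tower_alg_subalg hp finK) | apply: (alg_to_towerK hp finK)].
split=> [Dd algD|].
  by split; [apply: (alg_tower_tower hp finK) | apply: (tower_to_algK hp finK)].
split=> [Dd algD|W towW].
  have E := alg_to_jacE hp finK algD; split=> //.
  by rewrite E; apply: tower_to_jac_jacobson => //; apply: (alg_tower_tower hp finK).
have /choice[r rP] := rank_basis_exists hp finK towW.
exists r => i; split; first exact: rank_basis_der_dim.
  exact: (rank_basis_le hp towW (rP i)).
exact: rank_basis_field_dim.
Qed.
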